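(* Let $\Bbbk$ be a field, $V$ a finite set and $R=\Bbbk[V]$ the polynomial ring whose indeterminates are the elements of $V$. Let $I\subseteq R$ be the edge ideal of a bipartite graph on the vertex set $V$, and let $c=\operatorname{ht} I$. Then \[ e(R/I)\leq \frac{M_1M_2\cdots M_c}{c!}. \]
   Context: $R$ is graded with $\deg x=1$ for all $x\in V$. Graphs are simple. The edge ideal of a graph $G$ on $V$ is the ideal generated by the monomials $xy$ such that $xy$ is an edge of $G$. $e(R/I)$ denotes the Hilbert-Samuel multiplicity of $R/I$. $M_l=M_l(I)=\max\{j:\operatorname{Tor}_l^R(\Bbbk,R/I)_j\neq 0\}$ is the largest twist in the $l$-th module of a minimal graded free resolution of $R/I$. *)

(* Defs.v *)
From HB Require Import structures.
From mathcomp Require Import all_boot all_order all_algebra.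
From mathcomp Require Export mpoly.

Set Implicit Arguments.
Unset Strict Implicit.
Unset Printing Implicit Defensive.

Import Order.TTheory GRing.Theory Num.Theory.
Local Open Scope ring_scope.

Section Ideals.
Variable R : comNzRingType.

(* Ideals are Prop-valued predicates, since membership in a generated ideal is
   not decidable in general.  Prime ideals, over which we only quantify, are
   boolean predicates, as in ring_quotient; [idealr_closed] includes
   properness. *)
Definition ideal_gen (S : R -> Prop) (p : R) : Prop :=
  exists (m : nat) (a g : 'I_m -> R),
    (forall i, S (g i)) /\ p = \sum_i a i * g i.

Definition ideal_add (I J : R -> Prop) (p : R) : Prop :=
  exists a b, [/\ I a, J b & p = a + b].

Definition ideal_pow (I : R -> Prop) (t : nat) : R -> Prop :=
  ideal_gen (fun p => exists s : 'I_t -> R,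
    (forall i, I (s i)) /\ p = \prod_i s i).

Definition prime_ideal (P : {pred R}) : Prop :=
  idealr_closed P /\ prime_idealr_closed P.

(* P 0, ..., P h is a strictly increasing chain of primes with P h = Q *)
Definition prime_chain_to (Q : {pred R}) (h : nat) (P : nat -> {pred R}) :
  Prop :=
  [/\ forall i, (i <= h)%N -> prime_ideal (P i),
      forall i, (i < h)%N ->
        {subset P i <= P i.+1} /\ ~ {subset P i.+1 <= P i}
    & P h =i Q].

Definition prime_height_is (Q : {pred R}) (h : nat) : Prop :=
  (exists P, prime_chain_to Q h P) /\
  (forall h' P, prime_chain_to Q h' P -> (h' <= h)%N).

Definition height_is (I : R -> Prop) (c : nat) : Prop :=
  (exists Q : {pred R},
     [/\ prime_ideal Q, forall p, I p -> p \in Q & prime_height_is Q c]) /\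
  (forall (Q : {pred R}) h,
     prime_ideal Q -> (forall p, I p -> p \in Q) -> prime_height_is Q h ->
     (c <= h)%N).

End Ideals.

Section PolynomialRing.
Variables (k : fieldType) (n : nat).
Local Notation R := {mpoly k[n]}.

Definition irrelevant_ideal : R -> Prop :=
  ideal_gen (fun p => exists i, p = 'X_i).

(* dim_k (R / J) = r : some r elements of R form a k-basis modulo J *)
Definition quotient_dim_is (J : R -> Prop) (r : nat) : Prop :=
  exists b : 'I_r -> R,
    forall p : R, exists! a : 'rV[k]_r, J (p - \sum_i a 0 i *: b i).

(* P is the Hilbert-Samuel polynomial of R / I at the irrelevant ideal m:
   P(t) is the length of R / (I + m^(t+1)) for t >> 0.  As R / m = k, this
   length is a dimension over k. *)
Definition hilbert_samuel_poly (I : R -> Prop) (P : {poly rat}) : Prop :=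
  exists t0, forall t, (t0 <= t)%N ->
    exists2 r, quotient_dim_is
                 (ideal_add I (ideal_pow irrelevant_ideal t.+1)) r
             & P.[t%:R] = r%:R.

(* e is (deg P)! times the leading coefficient of the Hilbert-Samuel
   polynomial P; deg P is the Krull dimension of R / I when I is a proper
   homogeneous ideal. *)
Definition multiplicity_is (I : R -> Prop) (e : rat) : Prop :=
  exists2 P, hilbert_samuel_poly I P
           & e = ((size P).-1)`!%:R * lead_coef P.

(* Data of a complex ... -> F_1 -> F_0 -> R / I with F_l the direct sum of the
   R(- gtwist l i), i < grank l.  Elements of F_l are row vectors, and
   gdiff l : F_(l+1) -> F_l acts by multiplication on the right.  The entries
   of gaug are representatives in R of the images of the basis of F_0. *)
Record graded_free_data := GradedFreeData {
  grank : nat -> nat;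
  gtwist : forall l, 'I_(grank l) -> nat;
  gdiff : forall l, 'M[R]_(grank l.+1, grank l);
  gaug : 'cV[R]_(grank 0)
}.

(* Since 0 is homogeneous of every degree, the second clause says that
   gdiff l i j is zero unless gtwist l j <= gtwist l.+1 i, and is then
   homogeneous of the difference of the twists. *)
Definition graded_free_resolution (I : R -> Prop) (F : graded_free_data) :
  Prop :=
  [/\ forall i, gaug F i 0 \is (gtwist i).-homog,
      forall l i j, gdiff F l i j != 0 ->
        exists2 d, (gtwist i = gtwist j + d)%N & gdiff F l i j \is d.-homog,
      forall p : R, exists u : 'rV[R]_(grank F 0), I (p - (u *m gaug F) 0 0),
      forall u : 'rV[R]_(grank F 0),
        I ((u *m gaug F) 0 0) <-> exists w, u = w *m gdiff F 0
    & forall l (u : 'rV[R]_(grank F l.+1)),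
        u *m gdiff F l = 0 <-> exists w, u = w *m gdiff F l.+1].

(* The differential of k (x) F: reduction modulo m keeps constant terms. *)
Definition gdiff_res (F : graded_free_data) (l : nat) :
  'M[k]_(grank F l.+1, grank F l) := map_mx (mcoeff 0%MM) (gdiff F l).

Definition res_cycle (F : graded_free_data) (l : nat) :
  'rV[k]_(grank F l) -> Prop :=
  match l return 'rV[k]_(grank F l) -> Prop with
  | 0 => fun _ => True
  | l'.+1 => fun v => v *m gdiff_res F l' = 0
  end.

(* The degree j strand of k (x) F_l is spanned by the basis vectors of
   degree j. *)
Definition res_degree (F : graded_free_data) (l j : nat)
    (v : 'rV[k]_(grank F l)) : Prop :=
  forall i, v 0 i != 0 -> gtwist i = j.

Definition res_homology_nz (F : graded_free_data) (l j : nat) : Prop :=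
  exists v : 'rV[k]_(grank F l),
    [/\ res_degree j v, res_cycle v
      & ~ exists2 w : 'rV[k]_(grank F l.+1),
            res_degree j w & v = w *m gdiff_res F l].

(* Tor_l^R(k, R / I)_j <> 0.  Tor does not depend on the resolution, which
   need not be minimal; R / I has resolutions by graded free modules of finite
   rank with nonnegative twists. *)
Definition tor_nz (I : R -> Prop) (l j : nat) : Prop :=
  exists2 F, graded_free_resolution I F & res_homology_nz F l j.

Definition max_twist_is (I : R -> Prop) (l m : nat) : Prop :=
  tor_nz I l m /\ forall j, tor_nz I l j -> (j <= m)%N.

End PolynomialRing.

Definition bipartite (V : finType) (E : rel V) : Prop :=
  exists A : {set V}, forall x y, E x y -> (x \in A) != (y \in A).

(* k[V] is {mpoly k[#|V|]}, the vertex x being the indeterminate of index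
   enum_rank x. *)
Definition edge_ideal (k : fieldType) (V : finType) (E : rel V) :
  {mpoly k[#|V|]} -> Prop :=
  ideal_gen (fun p =>
    exists x y, E x y /\ p = 'X_(enum_rank x) * 'X_(enum_rank y)).

Arguments edge_ideal k {V} E.

(* Main.v *)
Require Import Defs.
From HB Require Import structures.
From mathcomp Require Import all_boot all_order all_algebra.
From mathcomp Require Import zify.
From Stdlib Require Import Classical.
Import Order.TTheory GRing.Theory Num.Theory.
Local Open Scope ring_scope.

Set Implicit Arguments.
Unset Strict Implicit.

(** Write [tau] for the least size of a vertex cover of the graph. Counting
    standard monomials shows that the Hilbert-Samuel polynomial of [R / I] is
    the sum of the binomial polynomials [binomial_poly #|S|] over the
    independent sets [S], so that [e] is the number of vertex covers of size
    [tau] ([multiplicity_min_covers]). Since a prime containing [I] contains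
    the variables of a vertex cover, [tau <= c] ([height_ge_vertex_cover]).

    Combinatorics. By Koenig's theorem there is a matching [X t -- Y t] with
    [tau] edges, and a minimum cover consists of exactly one end of each of
    them. Order the edges of the matching by [s <= t] iff every minimum cover
    containing [X s] contains [X t], and let [P] be a set of representatives
    for the resulting equivalence, a poset with [d] elements and width [r]. A
    minimum cover is determined by its trace on [P], which is an up-set. By
    Dilworth's theorem [P] is a union of [r] chains, so there are at most
    [\prod_i (lambda_i + 1) <= ((d + r) / r) ^+ r] minimum covers, where the
    [lambda_i] are the sizes of the chains.

    Algebra. It remains to see that [M_l >= l + minn l r] for [1 <= l <= d]
    and [M_l >= l] for all [l]: by Bernoulli's inequality, the product of the
    [(l + minn l r) / l] over [1 <= l <= d] is at least [((d + r) / r) ^+ r]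
    ([mean_power_bound]). The bound [M_l >= l] holds for every ideal
    ([tor_degree_ge]). For the other one, take a subset [L] of [P] with [l]
    elements that is contained in a maximum antichain [A] or contains it, and
    let [W] be the set of all [X t] and [Y t] with [t] in [L]. On
    [R_W = R / (variables outside W)] the monomials [X t * Y t], [t] in [L],
    form a regular sequence contained in [I]. Dimension shifting therefore
    embeds [Hom(R / I, R_W / (X t * Y t : t \in L))] into [Ext^l(R / I, R_W)]
    with degrees lowered by [2 l]. The monomial [g], product of the [X t] with
    [t] in [L] below some element of [A] and of the [Y t] with [t] in [L] above
    some element of [A], is nonzero modulo the sequence and multiplies [I] into
    it. It has degree [l - #|L :&: A|], hence gives a nonzero element of
    [Ext^l(R / I, R_W)] of degree [- (l + #|L :&: A|)]. Such an element forces
    [Tor_l(k, R / I)] to be nonzero in some degree at least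
    [l + #|L :&: A| = l + minn l r].

    All of this is done with an arbitrary graded free resolution, not assumed to
    be minimal. In place of minimality, exactness modulo the irrelevant ideal
    in certain degrees is lifted to the complex of free modules itself, step by
    step along the powers of that ideal ([graded_lifting]). *)

(** * Monomial ideals and lifting along the powers of the irrelevant ideal *)

Section MonomialIdeals.
Variables (k : fieldType) (n : nat).
Local Notation R := {mpoly k[n]}.
Implicit Types (p q : R) (m : 'X_{1..n}) (B : pred 'X_{1..n}).

Lemma mcoeffM_neq0 p q m : (p * q)@_m != 0 ->
  exists m1 m2, [/\ m = (m1 + m2)%MM, p@_m1 != 0 & q@_m2 != 0].
Proof.
rewrite -mcoeff_msupp => /msuppM_le /allpairsP[[m1 m2] /= [h1 h2 ->]].
by exists m1, m2; rewrite -!mcoeff_msupp.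
Qed.

(** If [m] is minimal among the monomials of [q], only the constant term of
    [p] contributes to the coefficient of [p * q] at [m]. *)
Lemma mcoeffM_low p q m :
    (forall m', (m' <= m)%MM -> m' != m -> q@_m' = 0) ->
  (p * q)@_m = p@_0%MM * q@_m.
Proof.
move=> qlow.
have {1}-> : q = q@_m *: 'X_[m] + (q - q@_m *: 'X_[m]) by rewrite addrC subrK.
have pX : (p * 'X_[m])@_m = p@_0%MM by rewrite -{1}(addm0 m) mcoeffMX.
rewrite mulrDr mcoeffD -scalerAr mcoeffZ pX.
suff /eqP-> : (p * (q - q@_m *: 'X_[m]))@_m == 0 by rewrite addr0 mulrC.
apply/contraT => /mcoeffM_neq0[m1 [m2 [em _]]].
rewrite mcoeffB mcoeffZ mcoeffX.
have [<-|ne] := eqVneq m m2; first by rewrite mulr1 subrr eqxx.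
rewrite mulr0 subr0 qlow ?eqxx //; last by rewrite eq_sym.
by rewrite em; apply: lem_addl.
Qed.

Lemma mcoeff_sum_neq0 (T : finType) (G : T -> R) m :
  (\sum_i G i)@_m != 0 -> exists i, (G i)@_m != 0.
Proof.
rewrite raddf_sum /= => nz; apply/existsP; apply: contraNT nz.
rewrite negb_exists => /forallP h; rewrite big1 // => i _.
by apply/eqP; move: (h i); rewrite negbK.
Qed.

Lemma mcoeff_mulmx_neq0 a b c (G : 'M[R]_(a, b)) (H : 'M[R]_(b, c)) i j m :
  ((G *m H) i j)@_m != 0 ->
  exists l m1 m2, [/\ m = (m1 + m2)%MM, (G i l)@_m1 != 0 & (H l j)@_m2 != 0].
Proof.
rewrite mxE => /mcoeff_sum_neq0[l /mcoeffM_neq0[m1 [m2 h]]].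
by exists l, m1, m2.
Qed.

Lemma mcoeff_sum_bmnm s (f : 'X_{1..n < s} -> k) (b : 'X_{1..n < s}) :
  (\sum_c f c *: 'X_[c])@_b = f b.
Proof.
rewrite raddf_sum /= (bigD1 b) //= mcoeffZ mcoeffX eqxx mulr1 big1 ?addr0 //.
by move=> c nb; rewrite mcoeffZ mcoeffX -bmeqP (negPf nb) mulr0.
Qed.

Lemma mcoeff_sum_bmnm_neq0 s (f : 'X_{1..n < s} -> k) m :
  (\sum_c f c *: 'X_[c])@_m != 0 -> exists2 b : 'X_{1..n < s}, m = b & f b != 0.
Proof.
case: (ltnP (mdeg m) s) => [lt|le].
  have -> : m = BMultinom lt by [].
  by rewrite mcoeff_sum_bmnm; exists (BMultinom lt).
rewrite raddf_sum /= big1 ?eqxx // => c _; rewrite mcoeffZ mcoeffX.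
case: eqP => [e|_]; last by rewrite mulr0.
by move: (bmdeg c); rewrite e ltnNge le.
Qed.

(** [B] is the set of all the monomials of the ideal, not of generators; the
    polynomials supported on [B] form an ideal if [B] is upward closed. *)
Definition monomial_ideal B p : Prop := forall m, p@_m != 0 -> B m.

Definition upward_closed B := forall m m', B m -> B (m + m')%MM.

Section Closure.
Variables (B : pred 'X_{1..n}) (Bup : upward_closed B).

Lemma monomial_ideal0 : monomial_ideal B 0.
Proof. by move=> m; rewrite mcoeff0 eqxx. Qed.

Lemma monomial_idealD p q :
  monomial_ideal B p -> monomial_ideal B q -> monomial_ideal B (p + q).
Proof.
move=> hp hq m; rewrite mcoeffD; have [->|/hp //] := eqVneq p@_m 0.
by rewrite add0r => /hq.
Qed.

Lemma monomial_idealN p : monomial_ideal B p -> monomial_ideal B (- p).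
Proof. by move=> hp m; rewrite mcoeffN oppr_eq0 => /hp. Qed.

Lemma monomial_idealM p q : monomial_ideal B q -> monomial_ideal B (p * q).
Proof.
by move=> hq m /mcoeffM_neq0[m1 [m2 [-> _ /hq hm]]]; rewrite addmC; apply: Bup.
Qed.

Lemma monomial_ideal_sum (I : Type) (r : seq I) (P : pred I) (F : I -> R) :
  (forall i, P i -> monomial_ideal B (F i)) ->
  monomial_ideal B (\sum_(i <- r | P i) F i).
Proof.
move=> h; apply: big_ind => //; [exact: monomial_ideal0|exact: monomial_idealD].
Qed.

Lemma monomial_idealX m : B m -> monomial_ideal B 'X_[m].
Proof. by move=> h m'; rewrite mcoeffX; case: (m =P m') => [<-|_] //; rewrite eqxx. Qed.

End Closure.

Definition mx_in a b (J : R -> Prop) (w : 'M[R]_(a, b)) :=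
  forall i j, J (w i j).

Lemma mx_inD a b B (v w : 'M[R]_(a, b)) :
  mx_in (monomial_ideal B) v -> mx_in (monomial_ideal B) w ->
  mx_in (monomial_ideal B) (v + w).
Proof. by move=> hv hw i j; rewrite mxE; apply: monomial_idealD. Qed.

Lemma mx_inN a b B (v : 'M[R]_(a, b)) :
  mx_in (monomial_ideal B) v -> mx_in (monomial_ideal B) (- v).
Proof. by move=> hv i j; rewrite mxE; apply: monomial_idealN. Qed.

Lemma mx_inB a b B (v w : 'M[R]_(a, b)) :
  mx_in (monomial_ideal B) v -> mx_in (monomial_ideal B) w ->
  mx_in (monomial_ideal B) (v - w).
Proof. by move=> hv hw; apply: mx_inD => //; apply: mx_inN. Qed.

Lemma mx_inM a b c B (u : 'M[R]_(a, b)) (v : 'M[R]_(b, c)) :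
  upward_closed B ->
  mx_in (monomial_ideal B) v -> mx_in (monomial_ideal B) (u *m v).
Proof.
move=> Bup hv i j; rewrite mxE; apply: monomial_ideal_sum => l _.
exact: monomial_idealM.
Qed.

Lemma mx_inZ a b B p (v : 'M[R]_(a, b)) :
  upward_closed B ->
  mx_in (monomial_ideal B) v -> mx_in (monomial_ideal B) (p *: v).
Proof. by move=> Bup hv i j; rewrite mxE; apply: monomial_idealM. Qed.

End MonomialIdeals.

Section GradedLifting.
Variables (k : fieldType) (n : nat).
Local Notation R := {mpoly k[n]}.
Local Notation res := (map_mx (mcoeff 0%MM)).

(** Let [alpha *m beta = 0], where [beta] is homogeneous of degree 0 for the
    twists [tb] and [tc]. If modulo the irrelevant ideal the complex is exact
    at the middle term in the degrees [j0 + s], [s0 <= s], then every cocycle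
    [w] of degree [- j0] that vanishes to order [s0] is a coboundary, also
    modulo a monomial ideal: the lowest part of [w] is, monomial by monomial, a
    residual cocycle, and subtracting a coboundary with the same lowest part
    raises the order of vanishing. Homogeneity bounds the degrees of the
    entries of [w], so this stops. The twists are integers because the lemma is
    used both for a resolution, transposed and with opposite twists, and for
    its dual. *)
Lemma graded_lifting (a b c : nat) (B : pred 'X_{1..n})
    (alpha : 'M[R]_(a, b)) (beta : 'M[R]_(b, c))
    (tb : 'I_b -> int) (tc : 'I_c -> int) (j0 : int) (s0 N : nat) :
    upward_closed B ->
    (forall i j m, (beta i j)@_m != 0 -> tb i = tc j + (mdeg m)%:Z) ->
    alpha *m beta = 0 ->
    (forall s (y : 'cV[k]_b), (s0 <= s)%N ->
       (forall i, y i 0 != 0 -> tb i = j0 + s%:Z) -> res alpha *m y = 0 ->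
       exists2 u : 'cV[k]_c, (forall j, u j 0 != 0 -> tc j = j0 + s%:Z)
                           & y = res beta *m u) ->
    (forall i, tb i <= j0 + N%:Z) ->
  forall w : 'cV[R]_b,
    (forall i m, (w i 0)@_m != 0 -> tb i = j0 + (mdeg m)%:Z) ->
    (forall i m, ~~ B m -> (mdeg m < s0)%N -> (w i 0)@_m = 0) ->
    mx_in (monomial_ideal B) (alpha *m w) ->
  exists2 u : 'cV[R]_c,
    (forall j m, (u j 0)@_m != 0 -> tc j = j0 + (mdeg m)%:Z /\ (s0 <= mdeg m)%N)
    & mx_in (monomial_ideal B) (w - beta *m u).
Proof.
move=> Bup beta_hom ab0 exact_res bound w0 w0_hom w0_low aw0.
have [e [f [fE {}w0_low]]] : exists e f, (N < s0 + e + f)%N /\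
    forall (i : 'I_b) m, ~~ B m -> (mdeg m < s0 + e)%N -> (w0 i 0)@_m = 0.
  by exists 0%N, N.+1; split=> [|i m]; [lia|rewrite addn0; apply: w0_low].
(* [s0 + e] is the order of vanishing reached so far; [f] is the fuel. *)
elim: f e w0 w0_hom aw0 fE w0_low => [|f IHf] e w w_hom aw fE w_low.
  exists 0; first by move=> j m; rewrite mxE mcoeff0 eqxx.
  rewrite mulmx0 subr0 => i j m; rewrite ord1 => wm.
  apply/contraT => nB; move: (w_hom _ _ wm) (bound i) => -> h.
  by rewrite w_low ?eqxx // in wm; move: h; lia.
pose s := (s0 + e)%N.
have : forall m : 'X_{1..n < s.+1}, exists v : 'cV[k]_c,
    (forall j, v j 0 != 0 -> tc j = j0 + s%:Z /\ mdeg m = s) /\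
    (mdeg m = s -> ~~ B m -> \col_i (w i 0)@_m = res beta *m v).
  move=> m.
  have [nB|] := boolP ((mdeg m == s) && ~~ B m); last first.
    rewrite negb_and => /orP h; exists 0; split.
      by move=> j; rewrite mxE eqxx.
    by move=> /eqP ms nB; case: h => /negP //.
  case/andP: nB => /eqP ms nB.
  have [|i||u u_hom uE] := exact_res s (\col_i (w i 0)@_m).
  - exact: leq_addr.
  - by rewrite mxE => /w_hom; rewrite ms.
  - apply/colP => i; have aw_m : ((alpha *m w) i 0)@_m = 0.
      by apply/eqP; apply: contraNT nB => /aw.
    rewrite [RHS]mxE -aw_m !mxE raddf_sum /=; apply: eq_bigr => j _; rewrite !mxE.
    rewrite mcoeffM_low // => m' lm' nm'; apply: w_low.
      apply: contraNN nB => Bm'; rewrite -(submK lm') addmC; exact: Bup.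
    rewrite -/s -ms -(submK lm') mdegD -[X in (X < _)%N]add0n ltn_add2r lt0n.
    rewrite mdeg_eq0; apply: contraNneq nm' => m0.
    by rewrite -(submK lm') m0 add0m.
  by exists u; split => // j /u_hom ->.
move=> /fin_all_exists[E EP].
pose u : 'cV[R]_c := \col_j \sum_(m : 'X_{1..n < s.+1}) E m j 0 *: 'X_[m].
have u_hom j m : (u j 0)@_m != 0 -> tc j = j0 + (mdeg m)%:Z /\ mdeg m = s.
  rewrite mxE => /mcoeff_sum_bmnm_neq0[b' -> h].
  by have [/(_ _ h)[-> ->]] := EP b'.
have bu_hom i m : ((beta *m u) i 0)@_m != 0 ->
    tb i = j0 + (mdeg m)%:Z /\ (s <= mdeg m)%N.
  move=> /mcoeff_mulmx_neq0[j [m1 [m2 [-> /beta_hom -> /u_hom[-> <-]]]]].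
  by rewrite mdegD; split; lia.
have [||||u' u'_hom u'E] := IHf e.+1 (w - beta *m u).
- move=> i m; rewrite mxE mcoeffD; have [->|/w_hom //] := eqVneq (w i 0)@_m 0.
  by rewrite add0r mxE mcoeffN oppr_eq0 => /bu_hom[].
- by rewrite mulmxBr mulmxA ab0 mul0mx subr0.
- lia.
- move=> i m nB; rewrite addnS ltnS leq_eqVlt => /orP[/eqP ms|lt].
    have lt : (mdeg m < s.+1)%N by rewrite ms ltnS.
    have [_ /(_ ms nB)] := EP (BMultinom lt).
    move=> /colP/(_ i); rewrite [LHS]mxE /= => wE.
    rewrite mxE mcoeffD [fun_of_matrix (- _) _ _]mxE mcoeffN wE !mxE raddf_sum /= -sumrB.
    apply: big1 => j _; rewrite mxE.
    rewrite mcoeffM_low ?mxE.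
      have /= -> := mcoeff_sum_bmnm (fun m => E m j 0) (BMultinom lt).
      by rewrite subrr.
    move=> m' lm' nm'; apply/eqP; apply: contraNT nm' => nz.
    have [_ ms'] := u_hom j m' ltac:(by rewrite mxE).
    rewrite -(submK lm') -{1}(add0m m') eqm_add2r eq_sym -mdeg_eq0.
    by move: ms; rewrite -{1}(submK lm') mdegD ms' -/s; lia.
  rewrite mxE mcoeffD w_low // add0r mxE mcoeffN; apply/eqP.
  rewrite oppr_eq0; apply: contraTT lt => /bu_hom[_]; rewrite -leqNgt.
  by [].
exists (u + u').
  move=> j m; rewrite mxE mcoeffD.
  have [->|/u_hom[-> ->]] := eqVneq (u j 0)@_m 0; last first.
    by move=> _; split=> //; apply: leq_addr.
  by rewrite add0r => /u'_hom[].
by rewrite mulmxDr opprD addrA.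
Qed.

End GradedLifting.

(** * Graded free resolutions *)

(** The left kernel of [A] contains the rows of the transposed cokernel of
    [A^T], which detect the column space of [A]. *)
Lemma column_span (k : fieldType) (a b : nat) (A : 'M[k]_(a, b)) (y : 'cV[k]_a) :
  (forall v : 'rV[k]_a, v *m A = 0 -> v *m y = 0) -> exists u, y = A *m u.
Proof.
move=> h; suff /submxP[D yD] : (y^T <= A^T)%MS.
  by exists D^T; apply: trmx_inj; rewrite trmx_mul trmxK.
rewrite submxE; set K := cokermx A^T.
have KA : K^T *m A = 0 by rewrite -[A]trmxK -trmx_mul mulmx_coker trmx0.
rewrite -trmx_eq0 trmx_mul trmxK; apply/eqP/row_matrixP => i.
by rewrite row_mul row0; apply: h; rewrite -row_mul KA row0.
Qed.

Section Resolutions.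
Variables (k : fieldType) (n : nat).
Local Notation R := {mpoly k[n]}.
Local Notation res := (map_mx (mcoeff 0%MM)).
Variables (I : R -> Prop) (F : graded_free_data k n).
Hypothesis F_res : graded_free_resolution I F.
Local Notation D := (gdiff F).

Lemma gaug_homog i m : (gaug F i 0)@_m != 0 -> mdeg m = gtwist i.
Proof.
by case: F_res => h _ _ _ _; move: (h i) => /dhomogP h'; rewrite -mcoeff_msupp => /h'.
Qed.

Lemma gdiff_homog l i j m : (D l i j)@_m != 0 -> gtwist i = (gtwist j + mdeg m)%N.
Proof.
case: F_res => _ h _ _ _ nz; have Dnz : D l i j != 0.
  by apply: contraNneq nz => ->; rewrite mcoeff0.
have [d -> /dhomogP hd] := h l i j Dnz.
by move: nz; rewrite -mcoeff_msupp => /hd /= ->.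
Qed.

Lemma gdiff_res_homog l i j : gdiff_res F l i j != 0 -> gtwist i = gtwist j.
Proof. by rewrite mxE => /gdiff_homog; rewrite mdeg0 addn0. Qed.

Lemma gdiff_gdiff l : D l.+1 *m D l = 0.
Proof.
case: F_res => _ _ _ _ h; apply/row_matrixP => i; rewrite row_mul row0.
by apply/h; exists (delta_mx 0 i); rewrite rowE.
Qed.

Lemma gdiff_gaug (i : 'I_(grank F 1)) : I ((D 0 *m gaug F) i 0).
Proof.
case: F_res => _ _ _ h _.
have -> : (D 0 *m gaug F) i 0 = (row i (D 0) *m gaug F) 0 0.
  by rewrite -row_mul [RHS]mxE.
by apply/h; exists (delta_mx 0 i); rewrite rowE.
Qed.

Lemma factor_gdiff l a (A : 'M[R]_(a, grank F l.+1)) :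
  A *m D l = 0 -> exists H, A = H *m D l.+1.
Proof.
case: F_res => _ _ _ _ h A0.
have : forall i, exists w, row i A = w *m D l.+1.
  by move=> i; apply/h; rewrite -row_mul A0 row0.
move=> /fin_all_exists[w wE]; exists (\matrix_i w i).
by apply/row_matrixP => i; rewrite row_mul rowK.
Qed.

(** The residual differentials preserve the degree, so a preimage of a
    homogeneous element may be taken homogeneous. *)
Lemma res_degree_lift l j (v : 'rV[k]_(grank F l)) (y : 'rV[k]_(grank F l.+1)) :
  res_degree j v -> v = y *m gdiff_res F l ->
  exists2 w : 'rV[k]_(grank F l.+1), res_degree j w & v = w *m gdiff_res F l.
Proof.
move=> vj vE; exists (\row_i if gtwist i == j then y 0 i else 0).
  by move=> i; rewrite mxE; case: (gtwist i =P j) => // _; rewrite eqxx.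
apply/rowP => i; have [ij|ij] := eqVneq (gtwist i) j.
  rewrite vE !mxE; apply: eq_bigr => a _; rewrite [in RHS]mxE.
  have [->|/gdiff_res_homog ->] := eqVneq (gdiff_res F l a i) 0.
    by rewrite !mulr0.
  by rewrite ij eqxx.
have /eqP -> : v 0 i == 0 by apply: contraNT ij => /vj ->.
rewrite mxE big1 // => a _; rewrite mxE; case: eqP => [aj|]; last by rewrite mul0r.
have [->|/gdiff_res_homog e] := eqVneq (gdiff_res F l a i) 0.
  by rewrite mulr0.
by rewrite -e aj eqxx in ij.
Qed.

(** Induction on [l]. Lift a residual cycle [v] of degree [j <= l] in homological
    degree [l + 1] to the free module with constant entries. Its boundary [u] has no
    constant terms, and the parts of [u] of order [s >= 1] live on basis
    elements of degree [j - s < l], where the residual complex is exact by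
    induction; so [u] is the boundary of some [z] without constant terms. Then
    the lift of [v] minus [z] is a cycle, hence a boundary, and reduces to
    [v]. *)
Lemma tor_degree_ge_aux l : forall j (v : 'rV[k]_(grank F l)), (j < l)%N ->
  res_degree j v -> res_cycle v ->
  exists2 w : 'rV[k]_(grank F l.+1), res_degree j w & v = w *m gdiff_res F l.
Proof.
elim: l => [//|l IHl] j v; rewrite ltnS => jl vj vZ.
pose V : 'rV[R]_(grank F l.+1) := map_mx (@mpolyC n k) v.
have V0 : res V = v by apply/rowP => i; rewrite !mxE mcoeffC eqxx mulr1.
have resM a b c (P : 'M[R]_(a, b)) (Q : 'M[R]_(b, c)) : res (P *m Q) = res P *m res Q.
  exact: map_mxM.
have V_hom i m : (V 0 i)@_m != 0 -> gtwist i = j /\ m = 0%MM.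
  rewrite mxE mcoeffC mulf_eq0 negb_or => /andP[/vj ->].
  by case: (m =P 0%MM) => // _; rewrite eqxx.
have u_hom i m : ((V *m D l) 0 i)@_m != 0 -> j = (gtwist i + mdeg m)%N /\ (0 < mdeg m)%N.
  move=> nz; have m0 : (0 < mdeg m)%N.
    rewrite lt0n mdeg_eq0; apply: contraNneq nz => ->.
    have /rowP/(_ i) : res (V *m D l) = 0 by rewrite resM V0.
    by rewrite !mxE => ->.
  have [a [m1 [m2 [e /V_hom[aj m10] /gdiff_homog]]]] := mcoeff_mulmx_neq0 nz.
  by rewrite aj => ->; rewrite m0 e m10 add0m.
have [z z_low zE] : exists2 z : 'rV[R]_(grank F l.+1),
    res z = 0 & V *m D l = z *m D l.
  case: l IHl jl v vj vZ V V0 V_hom u_hom => [|l] IHl jl v vj vZ V V0 V_hom u_hom.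
    exists 0; first by rewrite map_mx0.
    rewrite mul0mx; apply/rowP => i; apply/mpolyP => m; rewrite [in RHS]mxE mcoeff0.
    apply/eqP/contraT => /u_hom[e]; move: jl; rewrite leqn0 => /eqP j0.
    by rewrite j0 in e; lia.
  have tD0 : (D l)^T *m (D l.+1)^T = 0 by rewrite -trmx_mul gdiff_gdiff trmx0.
  have exact_res s (y : 'cV[k]_(grank F l.+1)) : (1 <= s)%N ->
      (forall i, y i 0 != 0 -> - (gtwist i)%:Z = - j%:Z + s%:Z) ->
      res (D l)^T *m y = 0 ->
      exists2 u : 'cV[k]_(grank F l.+2),
        (forall i, u i 0 != 0 -> - (gtwist i)%:Z = - j%:Z + s%:Z)
        & y = res (D l.+1)^T *m u.
    move=> s1 y_hom Zy; have [y0|/cV0Pn[i0 /y_hom e0]] := eqVneq y 0.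
      exists 0; last by rewrite y0 mulmx0.
      by move=> i; rewrite mxE eqxx.
    have [|i||x x_hom xE] := IHl (j - s)%N y^T; first by lia.
    - by rewrite mxE => /y_hom; lia.
    - by apply: trmx_inj; rewrite trmx_mul trmxK trmx0 /gdiff_res matrix.map_trmx.
    exists x^T; first by move=> i; rewrite mxE => /x_hom ->; lia.
    by rewrite -matrix.map_trmx -trmx_mul -xE trmxK.
  have beta_hom i a m : ((D l.+1)^T i a)@_m != 0 ->
      - (gtwist i)%:Z = - (gtwist a)%:Z + (mdeg m)%:Z.
    by rewrite mxE => /gdiff_homog ->; lia.
  have up0 : upward_closed (pred0 : pred 'X_{1..n}) by [].
  have bound (i : 'I_(grank F l.+1)) : - (gtwist i)%:Z <= - j%:Z + j%:Z by lia.
  have [i m|i m _|i i'|w w_hom wE] :=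
    graded_lifting up0 beta_hom tD0 exact_res bound (w := (V *m D l.+1)^T).
  - by rewrite mxE => /u_hom[-> _]; lia.
  - rewrite ltnS leqn0 => /eqP m0; apply/eqP/contraT.
    by rewrite mxE => /u_hom[_]; rewrite m0.
  - move=> m; rewrite -trmx_mul -mulmxA gdiff_gdiff mulmx0 mxE [X in X@__]mxE.
    by rewrite mcoeff0 eqxx.
  exists w^T.
    apply/rowP => i; rewrite !mxE; apply/eqP/contraT => /w_hom[_].
    by rewrite mdeg0.
  apply: trmx_inj; rewrite [RHS]trmx_mul trmxK; apply/colP => i; apply/mpolyP => m.
  apply/eqP; rewrite -subr_eq0; apply/contraT => nz.
  have := wE i 0 m; rewrite mxE mcoeffD [fun_of_matrix (- _) _ _]mxE mcoeffN.
  by move=> /(_ nz).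
have /factor_gdiff[y yE] : (V - z) *m D l = 0 by rewrite mulmxBl zE subrr.
apply: (@res_degree_lift _ _ _ (res y)) => //.
rewrite -resM -yE; have := map_mxB (@mcoeff n k 0%MM) V z.
by move=> ->; rewrite z_low subr0.
Qed.

Lemma tor_degree_ge l j : res_homology_nz F l j -> (l <= j)%N.
Proof.
by move=> [v [vj vZ vB]]; rewrite leqNgt; apply/negP => /tor_degree_ge_aux h; apply/vB/h.
Qed.

(** The coboundaries of the complex [Hom(F, R)], whose cochains are column
    vectors and whose term in degree [-1] is zero. *)
Definition coboundary l : 'cV[R]_(grank F l) -> Prop :=
  match l return 'cV[R]_(grank F l) -> Prop with
  | 0 => fun w => w = 0
  | l'.+1 => fun w => exists u, w = D l' *m u
  end.

Lemma gdiff_coboundary l (w : 'cV[R]_(grank F l)) : coboundary w -> D l *m w = 0.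
Proof.
case: l w => [|l] w /=; first by move=> ->; rewrite mulmx0.
by move=> [u ->]; rewrite mulmxA gdiff_gdiff mul0mx.
Qed.

(** If [Tor_(l+1)(k, R / I)] vanishes in all degrees at least [j0], then
    [Ext^(l+1)(R / I, R / J)] vanishes in degree [- j0] for each monomial ideal
    [J]: duality over [k] turns the vanishing of residual homology into the
    exactness that [graded_lifting] asks for. *)
Lemma cocycle_coboundary l (B : pred 'X_{1..n}) (j0 : int) (w : 'cV[R]_(grank F l.+1)) :
    upward_closed B ->
    (forall d, j0 <= d%:Z -> ~ res_homology_nz F l.+1 d) ->
    (forall i m, (w i 0)@_m != 0 -> (gtwist i)%:Z = j0 + (mdeg m)%:Z) ->
    mx_in (monomial_ideal B) (D l.+1 *m w) ->
  exists2 w0, coboundary w0 & mx_in (monomial_ideal B) (w - w0).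
Proof.
move=> Bup noH w_hom wZ.
have [N NP] : exists N, forall i : 'I_(grank F l.+1), (gtwist i)%:Z <= j0 + N%:Z.
  exists (`|j0| + \max_(i < grank F l.+1) gtwist i)%N => i.
  have : (gtwist i <= \max_(i < grank F l.+1) gtwist i)%N by apply: leq_bigmax.
  by lia.
have beta_hom i j m : (D l i j)@_m != 0 ->
  (gtwist i)%:Z = (gtwist j)%:Z + (mdeg m)%:Z by move=> /gdiff_homog ->; lia.
have exact_res s (y : 'cV[k]_(grank F l.+1)) : (0 <= s)%N ->
    (forall i, y i 0 != 0 -> (gtwist i)%:Z = j0 + s%:Z) ->
    res (D l.+1) *m y = 0 ->
    exists2 u : 'cV[k]_(grank F l),
      (forall i, u i 0 != 0 -> (gtwist i)%:Z = j0 + s%:Z) & y = res (D l) *m u.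
  move=> _ y_hom yZ; have [y0|/cV0Pn[i0 /y_hom e0]] := eqVneq y 0.
    exists 0; last by rewrite y0 mulmx0.
    by move=> i; rewrite mxE eqxx.
  set d := gtwist i0 in e0.
  have y_d i : y i 0 != 0 -> gtwist i = d by move=> /y_hom; lia.
  have [v vZ|u uE] := @column_span _ _ _ (res (D l)) y.
    pose v' : 'rV[k]_(grank F l.+1) := \row_i if gtwist i == d then v 0 i else 0.
    have v'd : res_degree d v'.
      by move=> i; rewrite mxE; case: (gtwist i =P d) => // _; rewrite eqxx.
    (* As [y] is homogeneous, [v] may be replaced by its part of degree [d]. *)
    have -> : v *m y = v' *m y.
      apply/rowP => i; rewrite !mxE; apply: eq_bigr => a _; rewrite mxE.
      have [->|ya] := eqVneq (y a i) 0; first by rewrite !mulr0.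
      by rewrite ord1 in ya; rewrite (y_d _ ya) eqxx.
    have v'Z : v' *m res (D l) = 0.
      apply/rowP => i; rewrite [RHS]mxE mxE; have [id|id] := eqVneq (gtwist i) d.
        move/rowP/(_ i): vZ; rewrite [RHS]mxE mxE => vZ; rewrite -[RHS]vZ.
        apply: eq_bigr => a _; rewrite [v' _ _]mxE.
        have [->|/gdiff_res_homog ->] := eqVneq (gdiff_res F l a i) 0.
          by rewrite !mulr0.
        by rewrite id eqxx.
      apply: big1 => a _; rewrite [v' _ _]mxE; case: eqP => [ad|]; last by rewrite mul0r.
      have [->|/gdiff_res_homog e] := eqVneq (gdiff_res F l a i) 0.
        by rewrite mulr0.
      by rewrite -e ad eqxx in id.
    have [[w' _ v'E]|nb] := classic (exists2 w' : 'rV[k]_(grank F l.+2),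
        res_degree d w' & v' = w' *m gdiff_res F l.+1).
      by rewrite v'E -mulmxA yZ mulmx0.
    by case: (noH d); [lia|exists v'].
  exists (\col_i if gtwist i == d then u i 0 else 0).
    by move=> i; rewrite mxE; case: (gtwist i =P d) => [-> //|_]; rewrite eqxx.
  apply/colP => i; have [id|id] := eqVneq (gtwist i) d.
    rewrite {1}uE [LHS]mxE [RHS]mxE; apply: eq_bigr => a _.
    rewrite [(\col__ _) _ _]mxE.
    have [->|/gdiff_res_homog e] := eqVneq (gdiff_res F l i a) 0.
      by rewrite !mul0r.
    by rewrite -e id eqxx.
  have /eqP -> : y i 0 == 0 by apply: contraNT id => /y_d ->.
  rewrite mxE big1 // => a _; rewrite [(\col__ _) _ _]mxE.
  case: eqP => [ad|]; last by rewrite mulr0.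
  have [->|/gdiff_res_homog e] := eqVneq (gdiff_res F l i a) 0.
    by rewrite mul0r.
  by rewrite e ad eqxx in id.
have [u _ uE] := graded_lifting Bup beta_hom (gdiff_gdiff l) exact_res NP w_hom
  (fun i m _ (h : (mdeg m < 0)%N) => False_ind _ (notF h)) wZ.
by exists (D l *m u) => //; exists u.
Qed.

Hypothesis I_mul : forall a p, I p -> I (a * p).

(** Multiplication by an element of [I] is zero on [R / I], hence homotopic to
    zero on the resolution. The following two lemmas give the homotopy in degree
    0 and in positive degrees. *)
Lemma null_homotopy0 f : I f -> exists H, f%:M = H *m D 0.
Proof.
move=> If; case: F_res => _ _ _ h _.
have : forall i : 'I_(grank F 0), exists w, row i (f%:M) = w *m D 0.
  move=> i; apply/h.
  have -> : row i f%:M *m gaug F = f *: row i (gaug F).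
    by rewrite -row_mul mul_scalar_mx; apply/rowP => j; rewrite !mxE.
  by rewrite mxE mulrC; apply: I_mul.
move=> /fin_all_exists[w wE]; exists (\matrix_i w i).
by apply/row_matrixP => i; rewrite row_mul rowK.
Qed.

Lemma null_homotopy f l : I f -> exists H H', f%:M = H *m D l.+1 + D l *m H'.
Proof.
move=> If.
have step l' (G : 'M[R]_(grank F l', grank F l'.+1)) :
    D l' *m (f%:M - G *m D l') = 0 ->
  exists H, f%:M = H *m D l'.+1 + D l' *m G.
  move=> h; have [H HE] : exists H, f%:M - D l' *m G = H *m D l'.+1.
    apply: factor_gdiff; by rewrite mulmxBl -mulmxA -scalar_mxC -mulmxBr.
  by exists H; rewrite -HE subrK.
elim: l => [|l [H [H' HE]]].
  have [H HE] := null_homotopy0 If.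
  have [|G GE] := step 0%N H; first by rewrite -HE subrr mulmx0.
  by exists G, H.
have [|G GE] := step l.+1 H; last by exists G, H.
by rewrite HE addrAC subrr add0r mulmxA gdiff_gdiff mul0mx.
Qed.

End Resolutions.

(** * Vanishing of Ext along a regular sequence of monomials *)

Section ExtVanishing.
Variables (k : fieldType) (n : nat).
Local Notation R := {mpoly k[n]}.
Variables (I : R -> Prop) (F : graded_free_data k n).
Hypothesis F_res : graded_free_resolution I F.
Hypothesis I_mul : forall a p, I p -> I (a * p).
Local Notation D := (gdiff F).

(** Monomial ideals [J_0 <= J_1 <= ...] with [J_(s+1) = J_s + (f_s)] and [f_s] a
    nonzerodivisor modulo [J_s] for [s < N], described by their sets [B s] of
    monomials. *)
Record regular_monomials (N : nat) (B : nat -> pred 'X_{1..n})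
    (f : nat -> 'X_{1..n}) : Prop := RegularMonomials {
  regular_up : forall s, upward_closed (B s);
  regular_sub : forall s m, B s m -> B s.+1 m;
  regular_gen : forall s, (s < N)%N -> B s.+1 (f s);
  regular_dec : forall s m, (s < N)%N -> B s.+1 m -> B s m \/ (f s <= m)%MM;
  regular_nzd : forall s m, (s < N)%N -> B s (m + f s)%MM -> B s m
}.

Variables (N : nat) (B : nat -> pred 'X_{1..n}) (f : nat -> 'X_{1..n}).
Hypothesis reg : regular_monomials N B f.
Local Notation J s := (monomial_ideal (k:=k) (B s)).
Let up := regular_up reg.

Lemma regular_ideal_sub s a b (w : 'M[R]_(a, b)) : mx_in (J s) w -> mx_in (J s.+1) w.
Proof. by move=> h i j m /h; apply: (regular_sub reg). Qed.

Lemma regular_ideal_gen s a b (w : 'M[R]_(a, b)) :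
  (s < N)%N -> mx_in (J s.+1) ('X_[f s] *: w).
Proof.
move=> sN i j; rewrite mxE mulrC; apply: monomial_idealM; first exact: up.
by apply: monomial_idealX; apply: (regular_gen reg).
Qed.

Lemma regular_ideal_nzd s a b (w : 'M[R]_(a, b)) : (s < N)%N ->
  mx_in (J s) ('X_[f s] *: w) -> mx_in (J s) w.
Proof.
move=> sN h i j m nz; apply: (regular_nzd reg sN); apply: (h i j).
by rewrite mxE mulrC addmC mcoeffMX.
Qed.

(** The quotient [q] in [w = f_s q] modulo [J_s] takes its monomials from those
    of [w], so it inherits the homogeneity of [w]. *)
Lemma regular_ideal_dec s a (w : 'cV[R]_a) : (s < N)%N ->
  mx_in (J s.+1) w ->
  exists2 q : 'cV[R]_a, mx_in (J s) (w - 'X_[f s] *: q)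
    & forall i m, (q i 0)@_m != 0 -> (w i 0)@_(m + f s) != 0.
Proof.
move=> sN wJ.
pose q : 'cV[R]_a := \col_i \sum_(m <- msupp (w i 0) | ~~ B s m)
  (w i 0)@_m *: 'X_[m - f s].
have fle i m : m \in msupp (w i 0) -> ~~ B s m -> (f s <= m)%MM.
  rewrite mcoeff_msupp => /wJ h nB; case: (regular_dec reg sN h) => // Bm.
  by rewrite Bm in nB.
exists q => [i j|i m]; rewrite ?ord1 mxE.
  rewrite [fun_of_matrix (- _) _ _]mxE [fun_of_matrix (_ *: _) _ _]mxE mxE.
  have -> : 'X_[f s] * (\sum_(m <- msupp (w i 0) | ~~ B s m)
      (w i 0)@_m *: 'X_[m - f s]) =
      \sum_(m <- msupp (w i 0) | ~~ B s m) (w i 0)@_m *: 'X_[m].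
    rewrite mulr_sumr big_seq_cond [RHS]big_seq_cond.
    apply: eq_bigr => m /andP[/fle h /h le].
    by rewrite -scalerAr -mpolyXD addmC submK.
  rewrite {1}(mpolyE (w i 0)) (bigID (B s)) /= addrK.
  apply: monomial_ideal_sum => m Bm m'.
  by rewrite mcoeffZ mcoeffX; case: (m =P m') => [<- //|_]; rewrite mulr0 eqxx.
rewrite raddf_sum /= => nz.
have [m' [m's nB h]] : exists m', [/\ m' \in msupp (w i 0), ~~ B s m' & m = (m' - f s)%MM].
  case: (pickP [pred x : seq_sub (msupp (w i 0)) | ~~ B s (val x) & m == (val x - f s)%MM]).
    by move=> x /= /andP[h1 /eqP h2]; exists (val x); split => //; apply: (valP x).
  move=> h; case/negP: nz; rewrite big_seq_cond big1 // => m' /andP[m's nB].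
  rewrite mcoeffZ mcoeffX; have /= := h (SeqSub m's); rewrite nB /= eq_sym => ->.
  by rewrite mulr0.
by rewrite h (submK (fle _ _ m's nB)) -mcoeff_msupp.
Qed.

Hypothesis f_in : forall s, (s < N)%N -> I 'X_[f s].

(** If the sequence [f_s, ..., f_(N-1)] lies in [I], then
    [Ext^l(R / I, R / J_s) = 0] for [l < N - s]. This is the long exact
    sequence for multiplication by [f_s] on [R / J_s]: a null homotopy of [f_s] turns
    [f_s w] into the coboundary of [H' w], and [H' w] is a cocycle modulo
    [J_(s+1)] of lower degree, to which the induction applies. *)
Lemma ext_vanishing l : forall s (w : 'cV[R]_(grank F l)), (s + l < N)%N ->
  mx_in (J s) (D l *m w) ->
  exists2 w0, coboundary w0 & mx_in (J s) (w - w0).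
Proof.
elim: l => [|l IHl] s w sN Dw.
  rewrite addn0 in sN; exists 0; first by [].
  have [H HE] := null_homotopy0 F_res I_mul (f_in sN).
  rewrite subr0; apply: (regular_ideal_nzd sN).
  by rewrite -mul_scalar_mx HE -mulmxA; apply: mx_inM.
have sN' : (s < N)%N by lia.
have [H [H' HE]] := null_homotopy F_res I_mul l (f_in sN').
have fw : 'X_[f s] *: w = H *m (D l.+1 *m w) + D l *m (H' *m w).
  by rewrite -mul_scalar_mx HE mulmxDl -!mulmxA.
have [||w2 w2C] := IHl s.+1 (H' *m w); first by lia.
  have -> : D l *m (H' *m w) = 'X_[f s] *: w - H *m (D l.+1 *m w).
    by rewrite fw addrAC subrr add0r.
  apply: mx_inB; first exact: regular_ideal_gen.
  by apply: regular_ideal_sub; apply: mx_inM.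
move=> /(regular_ideal_dec sN')[w3 w3E _].
exists (D l *m w3); first by exists w3.
apply: (regular_ideal_nzd sN').
have -> : 'X_[f s] *: (w - D l *m w3) =
    H *m (D l.+1 *m w) + D l *m (H' *m w - w2 - 'X_[f s] *: w3).
  rewrite !mulmxBr (gdiff_coboundary F_res w2C) subr0 scalerBr fw -scalemxAr.
  by rewrite addrA.
by apply: mx_inD; apply: mx_inM.
Qed.

(** The multiple [w^0 = g * gaug F] of the augmentation is a nonzero
    homomorphism from [R / I] to [R / J_N]. The connecting homomorphisms of the
    sequences of multiplication by [f_(N-1), ..., f_0] carry it to cocycles
    [w^i] modulo [J_(N-i)], where [D w^i = f_(N-i-1) w^(i+1)] modulo
    [J_(N-i-1)]; they are injective because the preceding Ext groups vanish by
    [ext_vanishing]. The final class in [Ext^N(R / I, R / J_0)] is nonzero of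
    degree [mdeg g - 2 N], so [cocycle_coboundary] gives the claim. *)
Lemma tor_nonvanishing g : (0 < N)%N ->
    (forall s, (s < N)%N -> mdeg (f s) = 2%N) ->
    ~~ B N g -> (forall p, I p -> J N ('X_[g] * p)) ->
  exists2 j, (N.*2 <= j + mdeg g)%N & res_homology_nz F N j.
Proof.
move=> N0 f2 Bg gI.
have zigzag i : (i <= N)%N -> exists w : 'cV[R]_(grank F i),
    [/\ forall a m, (w a 0)@_m != 0 -> (gtwist a + mdeg g = i.*2 + mdeg m)%N,
        mx_in (J (N - i)) (D i *m w)
      & forall w0, coboundary w0 -> ~ mx_in (J (N - i)) (w - w0)].
  elim: i => [_|i IHi iN].
    exists ('X_[g] *: gaug F); rewrite subn0; split.
    - move=> a m; rewrite mxE.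
      move=> /mcoeffM_neq0[m1 [m2 [-> + /(gaug_homog F_res) <-]]].
      rewrite mcoeffX; case: (g =P m1) => [<- _|_]; last by rewrite eqxx.
      by rewrite mdegD addnC.
    - rewrite -scalemxAr => a b; rewrite mxE ord1; apply: gI.
      exact: gdiff_gaug F_res _.
    - move=> _ /= ->; rewrite subr0 => gJ.
      case: F_res => _ _ /(_ 1)[u Iu] _ _; case/negP: Bg.
      have : J N 'X_[g].
        have -> : 'X_[g] = 'X_[g] * (1 - (u *m gaug F) 0 0) +
            (u *m ('X_[g] *: gaug F)) 0 0 :> R.
          by rewrite -scalemxAr [in X in _ + X]mxE mulrBr mulr1 subrK.
        apply: monomial_idealD; first exact: gI.
        exact: (mx_inM (@up N) gJ).
      by move=> /(_ g); rewrite mcoeffX eqxx oner_eq0; apply.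
  have [w [w_hom wZ wB]] := IHi (ltnW iN).
  set s := (N - i.+1)%N; have sE : (N - i = s.+1)%N by rewrite /s; lia.
  have sN : (s < N)%N by rewrite /s; lia.
  rewrite sE in wZ wB; have [w' w'E w'_hom] := regular_ideal_dec sN wZ.
  exists w'; split.
  - move=> a m /w'_hom /mcoeff_mulmx_neq0[b [m1 [m2 [/(congr1 mdeg) e h1 h2]]]].
    move: (gdiff_homog F_res h1) (w_hom _ _ h2) e; rewrite !mdegD (f2 _ sN).
    by lia.
  - apply: (regular_ideal_nzd sN); rewrite scalemxAr.
    have -> : D i.+1 *m ('X_[f s] *: w') = - (D i.+1 *m (D i *m w - 'X_[f s] *: w')).
      by rewrite mulmxBr mulmxA (gdiff_gdiff F_res) mul0mx sub0r opprK.
    by apply: mx_inN; apply: mx_inM.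
  - move=> _ [u ->] w'B.
    have [||w0 w0C w0E] := ext_vanishing (s := s) (w := w - 'X_[f s] *: u);
      first by rewrite /s; lia.
      have -> : D i *m (w - 'X_[f s] *: u) =
          (D i *m w - 'X_[f s] *: w') + 'X_[f s] *: (w' - D i *m u).
        by rewrite mulmxBr scalerBr -scalemxAr addrA subrK.
      by apply: mx_inD => //; apply: mx_inZ.
    apply: (wB _ w0C).
    have -> : w - w0 = (w - 'X_[f s] *: u - w0) + 'X_[f s] *: u.
      by rewrite addrAC subrK.
    by apply: mx_inD; [apply: regular_ideal_sub|apply: regular_ideal_gen].
have [w [w_hom wZ wB]] := zigzag N (leqnn N).
apply: NNPP => noH.
case: N N0 w w_hom wZ wB noH => [//|N'] _ w w_hom wZ wB noH.
have noH' d : N'.+1.*2%:Z - (mdeg g)%:Z <= d%:Z -> ~ res_homology_nz F N'.+1 d.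
  by move=> hd Hd; apply: noH; exists d => //; lia.
have w_hom' a m : (w a 0)@_m != 0 ->
    (gtwist a)%:Z = N'.+1.*2%:Z - (mdeg g)%:Z + (mdeg m)%:Z.
  by move=> /w_hom; lia.
have [w0 w0C w0E] := cocycle_coboundary F_res (@up _) noH' w_hom' wZ.
exact: wB w0C w0E.
Qed.

End ExtVanishing.

(** * Generated ideals *)

Section GeneratedIdeals.
Variables (R : comNzRingType) (S : R -> Prop).

Lemma ideal_gen0 : ideal_gen S 0.
Proof. by exists 0%N, (fun=> 0), (fun=> 0); split=> [[]//|]; rewrite big_ord0. Qed.

Lemma ideal_genD p q : ideal_gen S p -> ideal_gen S q -> ideal_gen S (p + q).
Proof.
move=> [m [a [g [hg ->]]]] [m' [a' [g' [hg' ->]]]].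
pose glue (T : Type) (u : 'I_m -> T) (u' : 'I_m' -> T) i :=
  match split i with inl j => u j | inr j => u' j end.
exists (m + m')%N, (glue _ a a'), (glue _ g g'); split.
  by move=> i; rewrite /glue; case: split => j.
rewrite big_split_ord /=; congr (_ + _); apply: eq_bigr => i _; rewrite /glue.
  by rewrite -[lshift _ _]/(unsplit (inl i)) unsplitK.
by rewrite -[rshift _ _]/(unsplit (inr i)) unsplitK.
Qed.

Lemma ideal_gen_mul a p : ideal_gen S p -> ideal_gen S (a * p).
Proof.
move=> [m [b [g [hg ->]]]]; exists m, (fun i => a * b i), g; split=> //.
by rewrite mulr_sumr; apply: eq_bigr => i _; rewrite mulrA.
Qed.

Lemma ideal_gen_mem p : S p -> ideal_gen S p.
Proof.
by move=> h; exists 1%N, (fun=> 1), (fun=> p); split=> //; rewrite big_ord1 mul1r.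
Qed.

End GeneratedIdeals.

(** * Nonvanishing of Tor for edge ideals *)

Section EdgeIdealTor.
Variables (k : fieldType) (V : finType) (E : rel V).
Local Notation n := #|V|.
Local Notation R := {mpoly k[n]}.
Local Notation I := (edge_ideal k E).

Lemma edge_ideal_edge x y : E x y -> I 'X_[U_(enum_rank x) + U_(enum_rank y)].
Proof.
move=> xy; exists 1%N, (fun=> 1), (fun=> 'X_(enum_rank x) * 'X_(enum_rank y)).
by split=> [_|]; [exists x, y|rewrite big_ord1 mul1r mpolyXD].
Qed.

Lemma edge_ideal_monomial (B : pred 'X_{1..n}) (g : 'X_{1..n}) :
    upward_closed B ->
    (forall x y, E x y -> B (g + (U_(enum_rank x) + U_(enum_rank y)))%MM) ->
  forall p : R, I p -> monomial_ideal B ('X_[g] * p).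
Proof.
move=> Bup hB p [m [a [h [hh ->]]]]; rewrite mulr_sumr.
apply: monomial_ideal_sum => i _; have [x [y [xy ->]]] := hh i.
rewrite mulrCA -!mpolyXD; apply: monomial_idealM => //.
by apply: monomial_idealX; apply: hB.
Qed.

Variables (T : finType) (X Y : T -> V).
Hypotheses (X_inj : injective X) (Y_inj : injective Y).
Hypothesis XY_neq : forall i j, X i != Y j.
Hypothesis XY_edge : forall i, E (X i) (Y i).
Hypothesis XX_no_edge : forall i j, ~~ E (X i) (X j).
Hypothesis YY_no_edge : forall i j, ~~ E (Y i) (Y j).
Hypothesis E_sym : symmetric E.

Section Restriction.
Variables (L : {set T}) (t0 : T).
Let t s := nth t0 (enum L) s.
Let xr i : 'I_n := enum_rank (X i).
Let yr i : 'I_n := enum_rank (Y i).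

Definition matched_edge (i : T) : 'X_{1..n} := (U_(xr i) + U_(yr i))%MM.

(** The monomials of the ideal generated by the variables outside the edges
    [X i -- Y i], [i] in [L], together with the first [s] of the products
    [X i * Y i]. *)
Definition restricted_monomials (s : nat) : pred 'X_{1..n} := fun m =>
  [exists v, [forall i in L, (v != xr i) && (v != yr i)] && (m v != 0%N)]
  || has (fun i => (m (xr (t i)) != 0%N) && (m (yr (t i)) != 0%N)) (iota 0 s).

Lemma xr_eq i j : (xr i == xr j) = (i == j).
Proof. by rewrite (inj_eq enum_rank_inj) (inj_eq X_inj). Qed.

Lemma yr_eq i j : (yr i == yr j) = (i == j).
Proof. by rewrite (inj_eq enum_rank_inj) (inj_eq Y_inj). Qed.

Lemma xr_yr i j : (xr i == yr j) = false.
Proof. by rewrite (inj_eq enum_rank_inj) (negPf (XY_neq i j)). Qed.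

Lemma yr_xr i j : (yr i == xr j) = false.
Proof. by rewrite eq_sym xr_yr. Qed.

Lemma restricted_monomialsP s (m : 'X_{1..n}) : reflect
  ((exists2 v, forall i, i \in L -> v != xr i /\ v != yr i & m v != 0%N) \/
   (exists i, [/\ (i < s)%N, m (xr (t i)) != 0%N & m (yr (t i)) != 0%N]))
  (restricted_monomials s m).
Proof.
apply: (iffP orP) => -[].
- case/existsP=> v /andP[/forall_inP h mv]; left; exists v => // i iL.
  by apply/andP; apply: h.
- by case/hasP=> i; rewrite mem_iota /= => h /andP[h1 h2]; right; exists i.
- case=> v h mv; left; apply/existsP; exists v; rewrite mv andbT.
  by apply/forall_inP => i iL; apply/andP; apply: h.
case=> i [h h1 h2]; right; apply/hasP; exists i; rewrite ?h1 ?mem_iota //.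
Qed.

Lemma regular_matching :
  regular_monomials #|L| restricted_monomials (fun s => matched_edge (t s)).
Proof.
have tL s : (s < #|L|)%N -> t s \in L.
  by move=> h; rewrite -mem_enum mem_nth // -cardE.
have t_eq i s : (i < s)%N -> (s < #|L|)%N -> (t i == t s) = false.
  move=> h1 h2; rewrite nth_uniq ?enum_uniq -?cardE //; last exact: ltn_trans h2.
  by rewrite ltn_eqF.
split.
- move=> s m m' /restricted_monomialsP h; apply/restricted_monomialsP.
  case: h => [[v hv mv]|[i [hi h1 h2]]]; [left; exists v|right; exists i] => //.
    by rewrite mnmDE addn_eq0 (negPf mv).
  by rewrite !mnmDE !addn_eq0 (negPf h1) (negPf h2).
- move=> s m /restricted_monomialsP h; apply/restricted_monomialsP.
  by case: h => [h|[i [hi h1 h2]]]; [left|right; exists i; split=> //; apply: ltnW].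
- move=> s sL; apply/restricted_monomialsP; right; exists s; split=> //.
    by rewrite !mnmDE !mnm1E eqxx.
  by rewrite !mnmDE !mnm1E eqxx addn1.
- move=> s m sL /restricted_monomialsP h; case: h => [h|[i [hi h1 h2]]].
    by left; apply/restricted_monomialsP; left.
  move: hi; rewrite ltnS leq_eqVlt => /orP[/eqP e|hi]; last first.
    by left; apply/restricted_monomialsP; right; exists i.
  right; apply/mnm_lepP => v; rewrite -e mnmDE !mnm1E.
  have [<-|_] := eqVneq (xr (t i)) v; first by rewrite yr_xr addn0 lt0n.
  by have [<-|//] := eqVneq (yr (t i)) v; rewrite add0n lt0n.
- move=> s m sL /restricted_monomialsP h; apply/restricted_monomialsP.
  case: h => [[v hv]|[i [hi]]].
    have [vx vy] := hv _ (tL _ sL); rewrite !mnmDE !mnm1E.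
    rewrite ![_ == v]eq_sym (negPf vx) (negPf vy) !addn0 => mv.
    by left; exists v.
  rewrite !mnmDE !mnm1E xr_yr yr_xr xr_eq yr_eq addn0 add0n.
  by rewrite ![t s == _]eq_sym !t_eq // !addn0 => h1 h2; right; exists i.
Qed.

End Restriction.

(** The monomial [g], product of the [X i] for [i] in [P] and the [Y i] for [i]
    in [Q], is not divisible by any [X i * Y i], and the last hypothesis says
    that [g] times any edge within the vertices of [L] is divisible by one of
    them. Edges leaving these vertices vanish under the restriction. *)
Lemma edge_ideal_tor_nonvanishing (F : graded_free_data k n) (L P Q : {set T}) :
    graded_free_resolution I F -> L != set0 ->
    P \subset L -> Q \subset L -> [disjoint P & Q] ->
    (forall i j, i \in L -> j \in L -> i != j -> E (X i) (Y j) ->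
       (j \in P) || (i \in Q)) ->
  exists2 j, (#|L|.*2 <= j + (#|P| + #|Q|))%N & res_homology_nz F #|L| j.
Proof.
move=> F_res /set0Pn[t0 t0L] PL QL PQ arcs.
have L0 : (0 < #|L|)%N by apply/card_gt0P; exists t0.
pose g : 'X_{1..n} := (\sum_(i in P) U_(enum_rank (X i)) +
  \sum_(i in Q) U_(enum_rank (Y i)))%MM.
have g_deg : mdeg g = (#|P| + #|Q|)%N.
  have cardE (S : {set T}) (Z : T -> 'I_n) : mdeg (\sum_(i in S) U_(Z i))%MM = #|S|.
    by rewrite mdeg_sum -[RHS]sum1_card; apply: eq_bigr => i _; rewrite mdeg1.
  by rewrite mdegD !cardE.
have gX i : (g (enum_rank (X i)) != 0%N) = (i \in P).
  rewrite mnmDE !mnm_sumE.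
  rewrite [X in (_ + X)%N]big1 ?addn0; last by move=> j _; rewrite mnm1E yr_xr.
  rewrite sum_nat_eq0 negb_forall; apply/existsP/idP => [[j]|iP]; last first.
    by exists i; rewrite iP mnm1E eqxx.
  by rewrite negb_imply mnm1E xr_eq => /andP[jP]; case: (j =P i) => // <-.
have gY i : (g (enum_rank (Y i)) != 0%N) = (i \in Q).
  rewrite mnmDE !mnm_sumE.
  rewrite [X in (X + _)%N]big1 ?add0n; last by move=> j _; rewrite mnm1E xr_yr.
  rewrite sum_nat_eq0 negb_forall; apply/existsP/idP => [[j]|iP]; last first.
    by exists i; rewrite iP mnm1E eqxx.
  by rewrite negb_imply mnm1E yr_eq => /andP[jP]; case: (j =P i) => // <-.
have reg := regular_matching L t0.
rewrite -g_deg; apply: (tor_nonvanishing F_res (@ideal_gen_mul _ _) reg) => //.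
- by move=> s _; apply: edge_ideal_edge.
- by move=> s _; rewrite mdegD !mdeg1.
- apply/restricted_monomialsP => -[[v hv]|[i [_]]]; last first.
    rewrite gX gY => h1 h2; move/pred0P/(_ (nth t0 (enum L) i)): PQ => /=.
    by rewrite h1 h2.
  rewrite mnmDE !mnm_sumE addn_eq0 negb_and !sum_nat_eq0 !negb_forall.
  case/orP => /existsP[i]; rewrite negb_imply mnm1E => /andP[ip].
    by have [+ _] := hv i (subsetP PL _ ip); rewrite eq_sym => /negPf ->.
  by have [_ +] := hv i (subsetP QL _ ip); rewrite eq_sym => /negPf ->.
apply: edge_ideal_monomial; first exact: (regular_up reg).
have mem_index i : i \in L -> exists2 s, (s < #|L|)%N & nth t0 (enum L) s = i.
  move=> iL; exists (index i (enum L)); last by rewrite nth_index ?mem_enum.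
  by rewrite cardE index_mem mem_enum.
(* By symmetry, let [y] be on the [X] side only if [x] is. *)
suff main x y : E x y -> [exists i in L, x == X i] || ~~ [exists i in L, y == X i] ->
   restricted_monomials L t0 #|L| (g + (U_(enum_rank x) + U_(enum_rank y)))%MM.
  move=> x y xy; have [h|h] := boolP ([exists i in L, x == X i] ||
    ~~ [exists i in L, y == X i]).
    exact: main.
  rewrite [X in (_ + X)%MM]addmC; apply: main; first by rewrite E_sym.
  by move: h; rewrite negb_or => /andP[_ /negPn ->].
move=> xy h; apply/restricted_monomialsP.
have out v : (g + (U_(enum_rank x) + U_(enum_rank y)))%MM (enum_rank v) != 0%N ->
   ~~ [exists i in L, v == X i] -> ~~ [exists i in L, v == Y i] ->
   exists2 v0, forall i, i \in L -> v0 != enum_rank (X i) /\ v0 != enum_rank (Y i)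
      & (g + (U_(enum_rank x) + U_(enum_rank y)))%MM v0 != 0%N.
  move=> nz hX hY; exists (enum_rank v) => // i iL; rewrite !(inj_eq enum_rank_inj).
  by split; [move: hX|move: hY]; apply: contraNneq => ->; apply/existsP; exists i;
    rewrite iL eqxx.
have nzx : (g + (U_(enum_rank x) + U_(enum_rank y)))%MM (enum_rank x) != 0%N.
  by rewrite !mnmDE !mnm1E eqxx; lia.
have nzy : (g + (U_(enum_rank x) + U_(enum_rank y)))%MM (enum_rank y) != 0%N.
  by rewrite !mnmDE !mnm1E eqxx; lia.
case: (boolP [exists i in L, x == X i]) h => [/existsP[i /andP[iL /eqP xE]] _|xX /= yX].
  have [/existsP[j /andP[jL /eqP yE]]|yY] := boolP [exists j in L, y == Y j]; last first.
    left; apply: out nzy _ yY; apply/negP => /existsP[j /andP[_ /eqP yE]].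
    by move: (XX_no_edge i j); rewrite -xE -yE xy.
  right; have [ij|ij] := eqVneq i j.
    have [s sL sE] := mem_index i iL; exists s; rewrite sE; split=> //.
      by rewrite -xE.
    by rewrite ij -yE.
  rewrite xE yE in xy; case/orP: (arcs i j iL jL ij xy) => [jP|iQ].
    have [s sL sE] := mem_index j jL; exists s; rewrite sE; split=> //; last by rewrite -yE.
    by rewrite mnmDE addn_eq0 negb_and gX jP.
  have [s sL sE] := mem_index i iL; exists s; rewrite sE; split=> //; first by rewrite -xE.
  by rewrite mnmDE addn_eq0 negb_and gY iQ.
left.
have [/existsP[i /andP[iL /eqP xE]]|xY] := boolP [exists i in L, x == Y i]; last first.
  exact: out nzx xX xY.
apply: out nzy yX _; apply/negP => /existsP[j /andP[_ /eqP yE]].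
by move: (YY_no_edge i j); rewrite -xE -yE xy.
Qed.

End EdgeIdealTor.

(** * Height and vertex covers *)

Definition vertex_cover {V : finType} (E : rel V) (C : {set V}) :=
  [forall x, forall y, E x y ==> (x \in C) || (y \in C)].

Lemma vertex_coverP {V : finType} (E : rel V) (C : {set V}) :
  reflect (forall x y, E x y -> (x \in C) || (y \in C)) (vertex_cover E C).
Proof.
apply: (iffP forallP) => [h x y xy|h x]; first by move/forallP/(_ y): (h x); rewrite xy.
by apply/forallP => y; apply/implyP; apply: h.
Qed.

Section VariablePrimes.
Variables (k : fieldType) (n : nat).
Local Notation R := {mpoly k[n]}.

Definition kill (S : {pred 'I_n}) (p : R) : R :=
  p \mPo [tuple if i \in S then 0 else 'X_i | i < n].

(** The ideal generated by the variables in [S], as the kernel of an endomorphism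
    of a domain, so that it is visibly prime. *)
Definition variable_prime (S : {pred 'I_n}) : {pred R} := fun p => kill S p == 0.

Lemma variable_primeP S : prime_ideal (variable_prime S).
Proof.
split; last first.
  by move=> u v; rewrite !unfold_in /variable_prime /kill rmorphM /= mulf_eq0.
split.
- by rewrite /variable_prime /kill unfold_in raddf0 eqxx.
- by rewrite unfold_in /variable_prime /kill comp_mpoly1 oner_eq0.
move=> a u v; rewrite !unfold_in /variable_prime /kill => /eqP hu /eqP hv.
by rewrite rmorphD rmorphM /= hu hv mulr0 addr0.
Qed.

Lemma variable_primeX S i : ('X_i \in variable_prime S) = (i \in S).
Proof.
rewrite unfold_in /variable_prime /kill comp_mpolyXU -tnth_nth tnth_mktuple.
case: ifP => _; first by rewrite eqxx.
apply/negbTE/eqP => /(congr1 (mcoeff U_(i))); rewrite mcoeffXU eqxx mcoeff0.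
by apply/eqP; rewrite oner_eq0.
Qed.

(** Every polynomial is congruent to its image under [kill S] modulo the
    variables in [S]. *)
Lemma variable_prime_sub S (Q : {pred R}) :
  idealr_closed Q -> (forall i, i \in S -> 'X_i \in Q) ->
  {subset variable_prime S <= Q}.
Proof.
move=> Qid SQ; have [Q0 Q1 QD] := Qid.
have QDD u v : u \in Q -> v \in Q -> u + v \in Q.
  by move=> hu hv; rewrite -[u]mul1r QD.
have QM a u : u \in Q -> a * u \in Q by move=> hu; rewrite -[a * u]addr0 QD.
suff h p : p - kill S p \in Q.
  by move=> p /eqP kp; have := h p; rewrite kp subr0.
elim/mpolyind: p => [|c m p _ _ IHp]; first by rewrite /kill raddf0 subr0.
rewrite /kill rmorphD /= opprD addrACA QDD //.
rewrite comp_mpolyZ -scalerBr -mul_mpolyC QM // comp_mpolyX mpolyXE_id.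
have [/existsP[i /andP[iS mi]]|nS] := boolP [exists i, (i \in S) && (m i != 0%N)].
  rewrite [X in _ - X](bigD1 i) //= tnth_mktuple iS expr0n (negPf mi) mul0r subr0.
  rewrite (bigD1 i) //= mulrC QM // -(prednK (n := m i)) ?lt0n // exprSr QM //.
  exact: SQ.
suff -> : \prod_(i < n) tnth [tuple if i \in S then 0 else 'X_i | i < n] i ^+ m i
   = \prod_(i < n) 'X_i ^+ m i :> R by rewrite subrr.
apply: eq_bigr => i _; rewrite tnth_mktuple; case: ifP => // iS.
have := existsPn nS i; rewrite iS /= negbK => /eqP ->.
by rewrite !expr0.
Qed.

End VariablePrimes.

(** Let [Q] be a prime of height [c] containing [I]. The vertices whose variables
    are in [Q] form a cover [C], and killing the variables of [C] one at a time
    gives a chain of primes of length [#|C|] that ends at [Q]. *)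
Lemma height_ge_vertex_cover (k : fieldType) (V : finType) (E : rel V) c :
  height_is (edge_ideal k E) c ->
  exists2 C : {set V}, vertex_cover E C & (#|C| <= c)%N.
Proof.
move=> [[Q [[Qid Qprime] IQ [_ Qmax]]] _].
pose C := [set v | 'X_(enum_rank v) \in Q].
exists C.
  apply/vertex_coverP => x y xy; rewrite !inE; apply: Qprime; apply: IQ.
  by rewrite -mpolyXD; apply: edge_ideal_edge.
pose S i : {pred 'I_#|V|} := fun v => enum_val v \in take i (enum C).
(* The last term is [Q] itself, which may be larger than the ideal of [C]. *)
pose P i : {pred {mpoly k[#|V|]}} := if (i < #|C|)%N then @variable_prime k _ (S i) else Q.
have memS i v : (v \in S i) = (enum_val v \in take i (enum C)) by [].
have SQ i v : v \in S i -> 'X_v \in Q.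
  move=> /mem_take; rewrite mem_enum inE.
  by rewrite enum_valK.
apply: (Qmax _ P); split; last by rewrite /P ltnn.
  by move=> i _; rewrite /P; case: ifP => // _; apply: variable_primeP.
move=> i iC.
have [v0 v0C] : exists v, v \in C by apply/card_gt0P; apply: leq_ltn_trans iC.
pose v := nth v0 (enum C) i.
have sz : (i < size (enum C))%N by rewrite -cardE.
have vC : v \in C by rewrite -mem_enum mem_nth.
have vS : enum_rank v \in S i = false.
  rewrite memS enum_rankK in_take ?mem_enum //.
  by rewrite index_uniq ?enum_uniq // ltnn.
have vP : 'X_(enum_rank v) \in P i = false.
  by rewrite /P iC variable_primeX.
rewrite {1 4}/P iC; case: (ltnP i.+1 #|C|) => iC'.
  rewrite /P iC'; split.
    apply: variable_prime_sub; first by case: (variable_primeP k (S i.+1)).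
    move=> j jS; rewrite variable_primeX; move: jS; rewrite !memS.
    by rewrite (take_nth v0) // mem_rcons inE => ->; rewrite orbT.
  move=> /(_ 'X_(enum_rank v)); rewrite !variable_primeX vS.
  suff -> : enum_rank v \in S i.+1 by move=> /(_ isT).
  by rewrite memS enum_rankK (take_nth v0) // mem_rcons mem_head.
rewrite /P ltnNge iC' /=; split; first by apply: variable_prime_sub => // j /SQ.
by move=> /(_ 'X_(enum_rank v)); rewrite variable_primeX vS; move: vC;
  rewrite inE => -> /(_ isT).
Qed.

(** * The Hilbert function of monomials *)

Section Truncation.
Variables (k : fieldType) (n : nat).
Local Notation R := {mpoly k[n]}.
Local Notation m_ideal := (@irrelevant_ideal k n).

Lemma irrelevant_ideal_low p : m_ideal p -> p@_0%MM = 0.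
Proof.
move=> [m [a [g [hg ->]]]]; rewrite raddf_sum big1 // => i _.
have [j ->] := hg i; apply/eqP/contraT => /mcoeffM_neq0[m1 [m2 [e _]]].
rewrite mcoeffX; case: (_ =P m2) => [e2|]; last by rewrite eqxx.
by move/(congr1 mdeg): e; rewrite -e2 mdegD mdeg1 mdeg0 addn1.
Qed.

Lemma prod_irrelevant_ideal N (s : 'I_N -> R) : (forall i, m_ideal (s i)) ->
  monomial_ideal (fun m => (N <= mdeg m)%N) (\prod_i s i).
Proof.
elim: N s => [|N IHN] s hs m //; rewrite big_ord_recl => /mcoeffM_neq0.
move=> [m1 [m2 [-> h1 /IHN h2]]]; rewrite mdegD.
have := h2 (fun i => hs _); suff : (0 < mdeg m1)%N by lia.
rewrite lt0n mdeg_eq0; apply: contraNneq h1 => ->.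
by rewrite irrelevant_ideal_low.
Qed.

Lemma monomial_in_ideal_pow N (m : 'X_{1..n}) : (N <= mdeg m)%N ->
  ideal_pow m_ideal N 'X_[m].
Proof.
move=> Nm; suff [a [s [hs ->]]] : exists a, exists s : 'I_N -> R,
    (forall i, m_ideal (s i)) /\ 'X_[m] = a * \prod_i s i.
  by apply: ideal_gen_mul; apply: ideal_gen_mem; exists s.
elim: N m Nm => [|N IHN] m Nm.
  by exists 'X_[m], (fun=> 0); split=> [[]//|]; rewrite big_ord0 mulr1.
have [i mi] : exists i, m i != 0%N.
  apply/existsP; apply: contraTT Nm; rewrite negb_exists => /forallP h.
  rewrite mdegE big1 // => i _; by apply/eqP; move: (h i); rewrite negbK.
have le : (U_(i) <= m)%MM by rewrite lep1mP.
have [|a [s [hs sE]]] := IHN (m - U_(i))%MM.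
  by move: Nm; rewrite -{1}(submK le) mdegD mdeg1; lia.
exists a, (fun j => if unlift ord0 j is Some j' then s j' else 'X_i); split.
  move=> j; case: unliftP => [j' _|_] //; apply: ideal_gen_mem; by exists i.
rewrite big_ord_recl unlift_none -{1}(submK le) mpolyXD sE -mulrA.
rewrite [X in a * X]mulrC; congr (a * (_ * _)).
by apply: eq_bigr => j _; rewrite liftK.
Qed.

(** Modulo [J] a polynomial is determined by its coefficients at the monomials
    in [St], and these are arbitrary. Hence the matrix of the coefficients of
    the elements of a basis is both row free and row full. *)
Lemma quotient_dim_monomials (J : R -> Prop) (t r : nat) (St : {set 'X_{1..n < t}}) :
    (forall p, J p <-> forall m : 'X_{1..n < t}, m \in St -> p@_m = 0) ->
  quotient_dim_is J r -> r = #|St|.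
Proof.
move=> JE [b hb].
pose M : 'M[k]_(r, #|St|) := \matrix_(i, j) (b i)@_(enum_val j : 'X_{1..n < t}).
have coefE (p : R) (a : 'rV[k]_r) j :
    (p - \sum_i a 0 i *: b i)@_(enum_val j : 'X_{1..n < t}) =
    p@_(enum_val j : 'X_{1..n < t}) - (a *m M) 0 j.
  rewrite mcoeffB raddf_sum mxE /=; congr (_ - _).
  by apply: eq_bigr => i _; rewrite mcoeffZ !mxE.
have /eqP fr : row_free M.
  apply: inj_row_free => v vM; have [a [_ a_uniq]] := hb 0.
  rewrite -(a_uniq v); last first.
    apply/JE => m mS; rewrite -(enum_rankK_in mS mS) coefE vM mcoeff0 mxE.
    by rewrite subr0.
  by apply: a_uniq; apply/JE => m _; rewrite big1 ?subr0 ?mcoeff0 // => i _;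
    rewrite mxE scale0r.
have /eqP fu : row_full M.
  rewrite -sub1mx; apply/row_subP => j.
  have [a [/JE aJ _]] := hb 'X_[(enum_val j : 'X_{1..n < t})].
  apply/submxP; exists a; apply/rowP => j'; rewrite !mxE.
  have := aJ _ (enum_valP j'); rewrite coefE mcoeffX -bmeqP (inj_eq enum_val_inj).
  by move=> /eqP; rewrite subr_eq0 => /eqP ->; rewrite mxE.
exact: etrans (esym fr) fu.
Qed.

End Truncation.

Section Counting.
Variable V : finType.
Local Notation n := #|V|.

Definition mnm_support (m : 'X_{1..n}) : {set V} := [set v | m (enum_rank v) != 0%N].

Lemma mdeg_support (m : 'X_{1..n}) : mdeg m = (\sum_(v in mnm_support m) m (enum_rank v))%N.
Proof.
rewrite mdegE (reindex (@enum_rank V)) /=; last exact: onW_bij (enum_rank_bij V).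
rewrite [LHS](bigID (mem (mnm_support m))) /= [X in (_ + X)%N]big1 ?addn0 //.
by move=> v; rewrite inE negbK => /eqP.
Qed.

(** Subtracting 1 from each exponent identifies these monomials with the tuples
    of [#|S|] naturals of sum at most [t - #|S|]. *)
Lemma card_support_monomials t (S : {set V}) :
  #|[set m : 'X_{1..n < t.+1} | mnm_support m == S]| = 'C(t, #|S|).
Proof.
have degS (m : 'X_{1..n}) : mnm_support m = S ->
    mdeg m = (#|S| + \sum_(v in S) (m (enum_rank v)).-1)%N.
  move=> mS; rewrite mdeg_support mS -sum1_card -big_split /=.
  by apply: eq_bigr => v; rewrite -mS inE; case: (m _).
case: (ltnP t #|S|) => [tS|St].
  rewrite bin_small //; apply/eqP; rewrite cards_eq0; apply/eqP/setP => m.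
  rewrite !inE; apply/negP => /eqP /degS mS; have := bmdeg m; lia.
pose N := (t - #|S|)%N.
rewrite -[t in RHS](subnKC St) -card_partial_ord_partitions -/N.
have sumS (h : V -> nat) : (\sum_(v in S) h v = \sum_(i < #|S|) h (enum_val i))%N.
  by rewrite big_enum_val.
pose g (m : 'X_{1..n < t.+1}) : #|S|.-tuple 'I_N.+1 :=
  [tuple inord (m (enum_rank (enum_val i))).-1 | i < #|S|].
have gE (m : 'X_{1..n < t.+1}) i : mnm_support m = S ->
  tnth (g m) i = (m (enum_rank (enum_val i))).-1 :> nat.
  move=> /degS mS; rewrite tnth_mktuple inordK // ltnS.
  have : ((m (enum_rank (enum_val i))).-1 <= \sum_(v in S) (m (enum_rank v)).-1)%N.
    by rewrite sumS (bigD1 i) //= leq_addr.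
  by move: (bmdeg m); rewrite mS /N; lia.
have g_inj : {in [set m : 'X_{1..n < t.+1} | mnm_support m == S] &, injective g}.
  move=> m1 m2; rewrite !inE => /eqP s1 /eqP s2 e; apply/val_inj/mnmP => i.
  rewrite -(enum_valK i); set v := enum_val i.
  have [vS|vS] := boolP (v \in S); last first.
    have := vS; rewrite -{1}s1 inE negbK => /eqP ->.
    by have := vS; rewrite -s2 inE negbK => /eqP ->.
  have := gE m1 (enum_rank_in vS v) s1; rewrite e gE // enum_rankK_in //.
  have := vS; rewrite -{1}s1 inE; have := vS; rewrite -{1}s2 inE.
  by rewrite -/v /=; lia.
apply/eqP; rewrite eqn_leq -{1}(card_in_imset g_inj); apply/andP; split.
  apply/subset_leq_card/subsetP => _ /imsetP[m + ->]; rewrite !inE => /eqP mS.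
  rewrite big_tuple (eq_bigr (fun i => (m (enum_rank (enum_val i))).-1)).
    by rewrite -(sumS (fun v => (m (enum_rank v)).-1)) /N; move: (bmdeg m) (degS _ mS); lia.
  by move=> i _; apply: gE.
rewrite -(card_in_imset g_inj); apply/subset_leq_card/subsetP => u.
rewrite inE big_tuple => hu.
pose m : 'X_{1..n} := [multinom
  (\sum_(i < #|S| | enum_val i == enum_val j) (tnth u i).+1)%N | j < n].
have mE i : m (enum_rank (enum_val i)) = (tnth u i).+1.
  rewrite mnmE enum_rankK (eq_bigl (pred1 i)) ?big_pred1_eq // => j /=.
  by rewrite (inj_eq enum_val_inj).
have mS : mnm_support m = S.
  apply/setP => v; rewrite inE; have [vS|vS] := boolP (v \in S).
    by rewrite -(enum_rankK_in vS vS) mE.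
  rewrite mnmE big1 // => i; rewrite enum_rankK => /eqP e.
  by move: vS; rewrite -e enum_valP.
have mt : (mdeg m < t.+1)%N.
  rewrite (degS _ mS) sumS (eq_bigr (fun i => tnth u i : nat)).
    by rewrite ltnS -[X in (_ <= X)%N](subnKC St) leq_add2l.
  by move=> i _; rewrite mE.
apply/imsetP; exists (BMultinom mt); first by rewrite inE /= mS.
by apply/eq_from_tnth => i; apply/ord_inj; rewrite gE //= mE.
Qed.

End Counting.

(** * The multiplicity of an edge ideal *)

Section HilbertFunction.
Variables (k : fieldType) (V : finType) (E : rel V).
Hypothesis E_irr : irreflexive E.
Local Notation n := #|V|.
Local Notation R := {mpoly k[n]}.
Local Notation I := (edge_ideal k E).

(** A set of vertices is independent iff its complement is a vertex cover, which
    is the form used here. *)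
Definition independent_monomial (m : 'X_{1..n}) := vertex_cover E (~: mnm_support m).

Lemma dependent_monomialP m : reflect
  (exists x y, E x y /\ (U_(enum_rank x) + U_(enum_rank y) <= m)%MM)
  (~~ independent_monomial m).
Proof.
apply: (iffP idP) => [|[x [y [xy le]]]]; last first.
  apply/negP => /vertex_coverP/(_ _ _ xy); rewrite !inE.
  move/mnm_lepP: le => le; move: (le (enum_rank x)) (le (enum_rank y)).
  rewrite !mnmDE !mnm1E !eqxx; case: (m (enum_rank x)) => [|a]; first by rewrite add1n.
  by case: (m (enum_rank y)) => [|b]; first by rewrite addn1.
rewrite /independent_monomial /vertex_cover negb_forall => /existsP[x].
rewrite negb_forall => /existsP[y].
rewrite negb_imply negb_or !inE !negbK => /andP[xy /andP[mx my]].
exists x, y; split=> //; apply/mnm_lepP => i; rewrite mnmDE !mnm1E.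
have [e|_] := eqVneq (enum_rank x) i; last first.
  by have [<-|//] := eqVneq (enum_rank y) i; rewrite lt0n.
rewrite -e (inj_eq enum_rank_inj); have [yx|_] := eqVneq y x.
  by rewrite yx E_irr in xy.
by rewrite addn0 lt0n.
Qed.

(** [I + m^(t+1)] is the monomial ideal generated by the edges and the monomials
    of degree [t + 1], whence its standard monomials. *)
Lemma truncated_edge_ideal t (p : R) :
  ideal_add I (ideal_pow (@irrelevant_ideal k n) t.+1) p <->
  forall m : 'X_{1..n < t.+1},
    m \in [set m : 'X_{1..n < t.+1} | independent_monomial m] -> p@_m = 0.
Proof.
split.
  move=> [a [b [Ia [N [c [h [hh ->]]]] ->]]] m; rewrite inE => im.
  rewrite mcoeffD; have -> : a@_m = 0.
    apply/eqP; apply: contraTT im => am.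
    have up : upward_closed (fun m => ~~ independent_monomial m).
      move=> m1 m2 /dependent_monomialP[x [y [xy le]]]; apply/dependent_monomialP.
      by exists x, y; split=> //; apply: lepm_trans le _; apply: lem_addr.
    apply: (edge_ideal_monomial up (g := 0%MM) _ Ia); last by rewrite mpolyX0 mul1r.
    by move=> x y xy; apply/dependent_monomialP; exists x, y; split=> //; apply: lem_addl.
  rewrite add0r; apply/eqP/contraT => /mcoeff_sum_neq0[i ci].
  have [s [hs hE]] := hh i.
  suff : (t.+1 <= mdeg m)%N by rewrite leqNgt bmdeg.
  have [m1 [m2 [-> _ h2]]] := mcoeffM_neq0 ci; rewrite mdegD.
  rewrite hE in h2; have := prod_irrelevant_ideal hs h2; lia.
move=> h.
exists (\sum_(m <- msupp p | ~~ independent_monomial m) p@_m *: 'X_[m]),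
  (\sum_(m <- msupp p | independent_monomial m) p@_m *: 'X_[m]); split.
- apply: big_ind; [exact: ideal_gen0|exact: ideal_genD|].
  move=> m /dependent_monomialP[x [y [xy le]]]; rewrite -(submK le) mpolyXD.
  rewrite -mul_mpolyC mulrA; apply: ideal_gen_mul; exact: edge_ideal_edge.
- rewrite big_seq_cond; apply: big_ind; [exact: ideal_gen0|exact: ideal_genD|].
  move=> m /andP[ms im]; rewrite -mul_mpolyC; apply: ideal_gen_mul.
  apply: monomial_in_ideal_pow; rewrite ltnNge; apply: contraTN ms => mt.
  have mt' : (mdeg m < t.+1)%N by [].
  by rewrite mcoeff_msupp -[m]/(bmnm (BMultinom mt')) h ?inE ?eqxx.
by rewrite {1}(mpolyE p) (bigID (fun m => ~~ independent_monomial m)) /=;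
  congr (_ + _); apply: eq_bigl => m; rewrite negbK.
Qed.

Lemma hilbert_function t r :
  quotient_dim_is (ideal_add I (ideal_pow (@irrelevant_ideal k n) t.+1)) r ->
  r = (\sum_(S : {set V} | vertex_cover E (~: S)) 'C(t, #|S|))%N.
Proof.
move=> /(quotient_dim_monomials (truncated_edge_ideal t)) ->.
rewrite -sum1_card (partition_big (fun m : 'X_{1..n < t.+1} => mnm_support m)
  (fun S => vertex_cover E (~: S))) /=; last by move=> m; rewrite inE.
apply: eq_bigr => S SE; rewrite -card_support_monomials -[RHS]sum1_card.
apply: eq_bigl => m; rewrite !inE /independent_monomial.
by case: eqP => [->|_]; rewrite ?SE ?andbF.
Qed.

End HilbertFunction.

Section BinomialPolynomials.

Definition binomial_poly (j : nat) : {poly rat} :=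
  (j`!%:R)^-1 *: \prod_(i < j) ('X - i%:R%:P).

Lemma fact_rat_neq0 j : (j`!%:R : rat) != 0.
Proof. by rewrite pnatr_eq0 -lt0n fact_gt0. Qed.

Lemma binomial_polyE j t : (binomial_poly j).[t%:R] = ('C(t, j))%:R.
Proof.
rewrite hornerZ horner_prod; apply: (mulfI (fact_rat_neq0 j)).
rewrite mulrA mulfV ?fact_rat_neq0 // mul1r -natrM mulnC bin_ffact.
have [jt|tj] := leqP j t.
  rewrite ffact_prod natr_prod; apply: eq_bigr => i _; rewrite hornerXsubC natrB //.
  by apply: ltnW; apply: leq_trans jt.
rewrite ffact_small // (bigD1 (Ordinal tj)) //= hornerXsubC subrr mul0r //.
Qed.

Lemma binomial_poly_monic j : \prod_(i < j) ('X - i%:R%:P) \is @monic rat.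
Proof. exact: monic_prod_XsubC. Qed.

Lemma size_binomial_poly j : size (binomial_poly j) = j.+1.
Proof.
by rewrite size_scale ?invr_eq0
  ?fact_rat_neq0 // size_prod_XsubC /index_enum -enumT size_enum_ord.
Qed.

Lemma binomial_poly_coef j : (binomial_poly j)`_j = (j`!%:R)^-1.
Proof.
have := monicP (binomial_poly_monic j).
rewrite coefZ lead_coefE size_prod_XsubC /index_enum -enumT size_enum_ord /=.
by move=> ->; rewrite mulr1.
Qed.

Lemma poly_eq_eventually (P Q : {poly rat}) t0 :
  (forall t, (t0 <= t)%N -> P.[t%:R] = Q.[t%:R]) -> P = Q.
Proof.
move=> h; apply/eqP; rewrite -subr_eq0; apply/negPn/negP => nz.
pose s := [seq (t0 + i)%:R : rat | i <- iota 0 (size (P - Q))].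
suff : (size s < size (P - Q)%R)%N by rewrite size_map size_iota ltnn.
apply: max_poly_roots nz _ _.
  apply/allP => _ /mapP[i _ ->]; rewrite /root hornerD hornerN h ?leq_addr //.
  by rewrite subrr.
rewrite map_inj_uniq ?iota_uniq // => i j /eqP; rewrite eqr_nat eqn_add2l.
by move=> /eqP.
Qed.

End BinomialPolynomials.

(** The binomial polynomial of [j] has degree [j] and leading coefficient
    [1 / j!]. So the degree of the Hilbert-Samuel polynomial is the largest size
    [a] of an independent set, and the number of independent sets of this size
    is [a!] times the leading coefficient. *)
Lemma multiplicity_min_covers (k : fieldType) (V : finType) (E : rel V) (e : rat) :
    irreflexive E -> multiplicity_is (edge_ideal k E) e ->
  exists2 tau, (exists2 C : {set V}, vertex_cover E C & #|C| = tau) /\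
      (forall C, vertex_cover E C -> (tau <= #|C|)%N)
    & e = #|[set C : {set V} | vertex_cover E C && (#|C| == tau)]|%:R.
Proof.
move=> E_irr [P [t0 hP] ->].
have cT : vertex_cover E [set: V] by apply/vertex_coverP => x y _; rewrite !inE.
case: (arg_minnP (fun C : {set V} => #|C|) cT) => C0 C0E C0min.
exists #|C0|; first by split; [exists C0|exact: C0min].
pose a := (#|V| - #|C0|)%N.
pose Q := \sum_(S : {set V} | vertex_cover E (~: S)) binomial_poly #|S|.
have PQ : P = Q.
  apply: (@poly_eq_eventually _ _ t0) => t /hP[r /(hilbert_function E_irr) -> ->].
  rewrite natr_sum /Q horner_sum; apply: eq_bigr => S _.
  by rewrite binomial_polyE.
have Sa S : vertex_cover E (~: S) -> (#|S| <= a)%N.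
  by move=> /C0min; rewrite /a -(cardsC S); lia.
have Qa : Q`_a = #|[set C : {set V} | vertex_cover E C && (#|C| == #|C0|)]|%:R / a`!%:R.
  rewrite coef_sum (bigID (fun S : {set V} => #|S| == a)) /=.
  rewrite [X in _ + X]big1 ?addr0; last first.
    move=> S /andP[/Sa h1 h2]; apply: nth_default; rewrite size_binomial_poly.
    by rewrite ltn_neqAle h2.
  rewrite (eq_bigr (fun=> (a`!%:R)^-1)).
    rewrite sumr_const -[LHS]mulr_natl; congr (_ * _); apply/eqP; rewrite eqr_nat;
      apply/eqP.
    rewrite -(card_imset _ (@setC_inj V)); apply: eq_card => C.
    rewrite inE; apply/imsetP/andP => [[S /andP[SE /eqP Sz] ->]|[CE /eqP Cz]].
      by split=> //; apply/eqP; move: (cardsC S) (max_card C0); rewrite Sz /a; lia.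
    exists (~: C); last by rewrite setCK.
    by rewrite unfold_in setCK CE /=; apply/eqP; move: (cardsC C); rewrite /a; lia.
  by move=> S /andP[_ /eqP ->]; rewrite binomial_poly_coef.
have Qnz : Q`_a != 0.
  rewrite Qa mulf_eq0 negb_or invr_eq0 fact_rat_neq0 andbT pnatr_eq0 cards_eq0.
  by apply/set0Pn; exists C0; rewrite inE C0E eqxx.
have sQ : size Q = a.+1.
  apply/eqP; rewrite eqn_leq; apply/andP; split; last first.
    by rewrite ltnNge; apply: contraNN Qnz => ?; rewrite nth_default.
  apply: leq_trans (size_sum _ _ _) _; apply/bigmax_leqP => S /Sa.
  by rewrite size_binomial_poly.
by rewrite PQ lead_coefE sQ /= Qa mulrC divfK ?fact_rat_neq0.
Qed.

(** * The theorems of Koenig and Dilworth *)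

Section Koenig.
Local Open Scope nat_scope.
Variables (V : finType) (A : {set V}).
Implicit Types (S M : {set V * V}) (C : {set V}).

Definition covers S C := [forall p in S, (p.1 \in C) || (p.2 \in C)].

Definition is_matching M := forall p q, p \in M -> q \in M ->
  (p.1 == q.1) || (p.2 == q.2) -> p = q.

(** Lovasz' proof. Choose [M] minimal among the sets of edges that have no cover
    with fewer than [tau] vertices, and suppose that two edges [p], [q] of [M]
    share a vertex [v]. Let [C1], [C2] be covers with fewer than [tau] vertices
    of [M] without [p] and of [M] without [q]. An edge of [M] that avoids
    [C1 :&: C2] has both ends in [W], which consists of [v] and the symmetric
    difference of [C1] and [C2]. So [C1 :&: C2] together with the smaller of
    the two sides of [W] covers [M], and it has fewer than [tau] elements. *)
Lemma koenig S tau :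
    (forall p, p \in S -> (p.1 \in A) && (p.2 \notin A)) ->
    (forall C, covers S C -> tau <= #|C|) ->
  exists M, [/\ M \subset S, is_matching M & tau <= #|M|].
Proof.
move=> SA Stau.
pose P S' := [forall C : {set V}, covers S' C ==> (tau <= #|C|)].
have PS : P S by apply/forallP => C; apply/implyP; apply: Stau.
have [M /minsetP[/forallP PM Mmin] MS] := minset_exists PS.
have tauM C : covers M C -> tau <= #|C| by move=> h; apply: (implyP (PM C)).
have Mcov C : tau > #|C| -> exists2 p, p \in M & (p.1 \notin C) && (p.2 \notin C).
  move=> lt; have : ~~ covers M C by apply: contraL lt; rewrite -leqNgt; apply: tauM.
  rewrite negb_forall => /existsP[p]; rewrite negb_imply negb_or => /andP[? ?].
  by exists p.
have cover_del p : p \in M -> exists C : {set V}, [/\ #|C| < tau,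
    forall q, q \in M -> q != p -> (q.1 \in C) || (q.2 \in C),
    p.1 \notin C & p.2 \notin C].
  move=> pM; have : ~~ P (M :\ p).
    apply/negP => h; have := Mmin _ h (subD1set _ _).
    by move/setP/(_ p); rewrite !inE eqxx pM.
  rewrite negb_forall => /existsP[C]; rewrite negb_imply -ltnNge => /andP[hC lt].
  have cC q : q \in M -> q != p -> (q.1 \in C) || (q.2 \in C).
    by move=> qM qp; move/forall_inP: hC; apply; rewrite !inE qp.
  have [q qM /andP[q1 q2]] := Mcov C lt.
  have [qp|qp] := eqVneq q p; first by exists C; split=> //; rewrite -qp.
  by have := cC q qM qp; rewrite (negPf q1) (negPf q2).
exists M; split=> //; last first.
  apply: leq_trans (tauM [set p.1 | p in M] _) (leq_imset_card _ _).
  by apply/forall_inP => p pM; rewrite imset_f.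
move=> p q pM qM pq; apply/eqP/negPn/negP => npq.
have [C1 [lt1 c1 p11 p21]] := cover_del p pM.
have [C2 [lt2 c2 q12 q22]] := cover_del q qM.
pose v := if p.1 == q.1 then p.1 else p.2.
have vp : (v == p.1) || (v == p.2) by rewrite /v; case: ifP; rewrite eqxx ?orbT.
have vq : (v == q.1) || (v == q.2).
  by rewrite /v; case: eqP pq => [->|_ /= ->]; rewrite ?eqxx ?orbT.
pose W := v |: ((C1 :\: C2) :|: (C2 :\: C1)).
have W_edge e : e \in M -> e.1 \notin C1 :&: C2 -> e.2 \notin C1 :&: C2 ->
    (e.1 \in W) && (e.2 \in W).
  move=> eM; rewrite !inE !negb_and.
  have [->|ep] := eqVneq e p.
    rewrite p11 p21 /= => _ _.
    have := c2 p pM npq; case/orP: vp => /eqP vE; rewrite -vE eqxx /=.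
      have -> : v \in C2 = false.
        by apply/negbTE; case/orP: vq => /eqP ->.
      by move=> /= ->; rewrite !orbT.
    have -> : v \in C2 = false.
      by apply/negbTE; case/orP: vq => /eqP ->.
    by rewrite orbF => ->; rewrite !orbT.
  have [->|eq] := eqVneq e q.
    rewrite q12 q22 !orbT /= => _ _.
    have := c1 q qM; rewrite eq_sym npq => /(_ isT).
    case/orP: vq => /eqP vE; rewrite -vE eqxx /=.
      have -> : v \in C1 = false.
        by apply/negbTE; case/orP: vp => /eqP ->.
      by move=> /= ->; rewrite !orbT.
    have -> : v \in C1 = false.
      by apply/negbTE; case/orP: vp => /eqP ->.
    by rewrite orbF => ->; rewrite !orbT.
  have := c1 e eM ep; have := c2 e eM eq.
  by case: (e.1 \in C1); case: (e.2 \in C1); case: (e.1 \in C2);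
    case: (e.2 \in C2) => //=; rewrite !orbT.
have cov (T : {set V}) : (forall e, e \in M -> e.1 \in W -> e.2 \in W -> (e.1 \in T) ||
  (e.2 \in T)) ->
    covers M (C1 :&: C2 :|: T).
  move=> hT; apply/forall_inP => e eM; rewrite !(in_setU _ _ T).
  have [//|e1] := boolP (e.1 \in C1 :&: C2).
  have [/=|e2 /=] := boolP (e.2 \in C1 :&: C2); first by rewrite orbT.
  by have /andP[] := W_edge e eM e1 e2; apply: hT.
have cW : #|W| + #|C1 :&: C2|.*2 <= 1 + #|C1| + #|C2|.
  have h1 := cardsID C2 C1; have h2 := cardsID C1 C2.
  have h3 := (leq_card_setU (C1 :\: C2) (C2 :\: C1)).1.
  have h4 := (leq_card_setU [set v] ((C1 :\: C2) :|: (C2 :\: C1))).1.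
  rewrite cards1 in h4; rewrite setIC in h2; rewrite /W.
  by clear -h1 h2 h3 h4; lia.
have h5 := cardsID A W.
have b1 : tau <= #|C1 :&: C2| + #|W :&: A|.
  apply: leq_trans (leq_card_setU _ _).1.
  apply/tauM/cov => e eM e1 e2; rewrite !(in_setI, e1, e2).
  by have /andP[-> _] := SA e (subsetP MS _ eM).
have b2 : tau <= #|C1 :&: C2| + #|W :\: A|.
  apply: leq_trans (leq_card_setU _ _).1.
  apply/tauM/cov => e eM e1 e2; rewrite !in_setD e1 e2.
  by have /andP[_ ->] := SA e (subsetP MS _ eM); rewrite orbT.
by clear -b1 b2 h5 cW lt1 lt2; lia.
Qed.

End Koenig.

Section Dilworth.
Local Open Scope nat_scope.
Variables (T : finType) (lt : rel T).
Hypotheses (lt_irr : irreflexive lt) (lt_trans : transitive lt).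

Definition antichain (A : {set T}) := forall p q, p \in A -> q \in A -> ~~ lt p q.

(** Apply Koenig's theorem to the graph on [T * bool] that joins [(p, true)] to
    [(q, false)] when [lt p q]. The points with neither copy in a minimum cover
    [C0] form an antichain with at least [#|D| - #|C0|] elements. A matching with
    at least [#|C0|] edges is an injective successor map [g] defined on as many
    points, and mapping each point to the end of its [g]-orbit gives at most
    [#|D| - #|C0|] fibres, which are chains. *)
Lemma dilworth (D : {set T}) : exists (A : {set T}) (f : T -> T),
  [/\ A \subset D, antichain A, #|f @: D| <= #|A|
    & forall p q, p \in D -> q \in D -> f p = f q -> [|| p == q, lt p q | lt q p]].
Proof.
pose side := [set x : T * bool | x.2].
pose S := [set e : (T * bool) * (T * bool) |
  [&& e.1.2, ~~ e.2.2, e.1.1 \in D, e.2.1 \in D & lt e.1.1 e.2.1]].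
have cT : covers S [set: T * bool] by apply/forall_inP => e _; rewrite !inE.
case: (arg_minnP (fun C : {set T * bool} => #|C|) cT) => C0 C0S C0min.
have [|M [MS Mm tauM]] := @koenig _ side S #|C0| _ C0min.
  by move=> e; rewrite !inE => /and5P[-> ->].
pose A := [set p in D | ((p, true) \notin C0) && ((p, false) \notin C0)].
pose S1 := [set p | [exists q, ((p, true), (q, false)) \in M]].
pose g p := if [pick q | ((p, true), (q, false)) \in M] is Some q then q else p.
have gM p : p \in S1 -> ((p, true), (g p, false)) \in M.
  rewrite inE => /existsP[q qM]; rewrite /g; case: pickP => [//|/(_ q)].
  by rewrite qM.
have gS p : p \in S1 -> [/\ p \in D, g p \in D & lt p (g p)].
  by move=> /gM /(subsetP MS); rewrite inE /= => /and3P[].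
have g_inj p q : p \in S1 -> q \in S1 -> g p = g q -> p = q.
  move=> /gM pM /gM qM e; have := Mm _ _ pM qM; rewrite e eqxx orbT => /(_ isT).
  by case.
have reach p : p \in D -> exists t m, [/\ t \in D :\: S1, iter m g p = t
    & forall i, i < m -> iter i g p \in S1].
  have [N] := ubnP #|[set q in D | lt p q]|; elim: N p => // N IHN p lN pD.
  have [pS|pS] := boolP (p \in S1); last first.
    by exists p, 0; rewrite in_setD pS pD.
  have [_ gD plt] := gS p pS.
  have [|t [m [tD mt mS]]] := IHN (g p) _ gD.
    rewrite -ltnS; apply: leq_trans lN; rewrite ltnS; apply: proper_card;
      apply/properP; split.
      by apply/subsetP => q; rewrite !inE => /andP[-> /(lt_trans plt)].
    by exists (g p); rewrite !inE gD ?plt ?lt_irr.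
  exists t, m.+1; split=> //; first by rewrite iterSr.
  by case=> [//|i] im; rewrite iterSr; apply: mS.
(* Two orbits with the same end agree near the end, as [g] is injective. *)
have merge t m n p q : m <= n -> iter m g p = t -> iter n g q = t ->
    (forall i, i < m -> iter i g p \in S1) -> (forall i, i < n -> iter i g q \in S1) ->
  iter (n - m) g q = p.
  elim: m n t => [|m IHm] [|n] t //; first by move=> _ <-.
    by move=> _ /= <- <-.
  rewrite ltnS => mn pt qt pS qS; rewrite subSS.
  apply: (IHm n (iter n g q)) => //; last 2 first.
  - by move=> i h; apply: pS; apply: ltnW.
  - by move=> i h; apply: qS; apply: ltnW.
  by apply: g_inj; [apply: pS|apply: qS|move: pt qt => /= -> ->].
have up j q : (forall i, i < j -> iter i g q \in S1) -> (iter j g q == q) ||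
  lt q (iter j g q).
  elim: j => [|j IHj] h; first by rewrite eqxx.
  have [_ _ /= l] := gS _ (h j (leqnn _)).
  have := IHj (fun i hi => h i (ltnW hi)).
  case/orP => [/eqP e|h'] /=; last by rewrite (lt_trans h' l) orbT.
  by rewrite e in l *; rewrite l orbT.
have : forall p, exists t, p \in D -> t \in D :\: S1 /\ exists m, iter m g p = t
    /\ forall i, i < m -> iter i g p \in S1.
  move=> p; have [pD|] := boolP (p \in D); last by exists p.
  by have [t [m [h1 h2 h3]]] := reach p pD; exists t => _; split=> //; exists m.
move=> /fin_all_exists[f fP].
exists A, f; split.
- by apply/subsetP => p; rewrite inE => /andP[].
- move=> p q; rewrite !inE => /and3P[pD p1 p2] /and3P[qD q1 q2]; apply/negP => pq.
  move/forall_inP/(_ ((p, true), (q, false))): C0S.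
  by rewrite inE /= pD qD pq (negPf p1) (negPf q2) => /(_ isT).
- have s1 : #|f @: D| <= #|D :\: S1|.
    by apply/subset_leq_card/subsetP => _ /imsetP[p /fP[h _] ->].
  have S1D : S1 \subset D by apply/subsetP => p /gS[].
  have s2 : #|M| <= #|S1|.
    have inj : {in M &, injective (fun e : (T * bool) * (T * bool) => e.1.1)}.
      move=> e e' eM e'M /= e11; apply: Mm => //; apply/orP; left.
      have := subsetP MS _ eM; have := subsetP MS _ e'M; rewrite !inE.
      case: e e' e11 {eM e'M} => [[a b] [c d]] [[a' b'] [c' d']] /= ->.
      by move=> /andP[-> _] /andP[-> _].
    rewrite -(card_in_imset inj); apply/subset_leq_card/subsetP => _ /imsetP[e eM ->].
    rewrite inE; apply/existsP; exists e.2.1; have := subsetP MS _ eM; rewrite inE.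
    case: e eM => [[a b] [c d]] /= eM /and3P[b1 d0 _].
    by move: eM; rewrite b1 (negPf d0).
  have s3 : #|D :\: A| <= #|C0|.
    apply: leq_trans (leq_imset_card (@fst T bool) C0).
    apply/subset_leq_card/subsetP => p; rewrite !inE => /andP[+ pD].
    rewrite pD /= negb_and !negbK => /orP[] h;
      [exact: (imset_f fst h)|exact: (imset_f fst h)].
  have AD : A \subset D by apply/subsetP => p; rewrite inE => /andP[].
  have := cardsID A D; have := cardsID S1 D.
  rewrite (setIidPr S1D) (setIidPr AD).
  by clear -s1 s2 s3 tauM; lia.
move=> p q pD qD.
have [_ [m [hp pS]]] := fP p pD; have [_ [n [hq qS]]] := fP q qD => e.
case: (leqP m n) => mn.
  have h := merge (f p) m n p q mn hp (etrans hq (esym e)) pS qS.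
  have := up (n - m) q; rewrite h => /(_ _) /orP[i hi|/eqP ->|->]; rewrite ?eqxx ?orbT //.
  by apply: qS; apply: leq_trans hi (leq_subr _ _).
have h := merge (f p) n m q p (ltnW mn) (etrans hq (esym e)) hp qS pS.
have := up (m - n) p; rewrite h => /(_ _) /orP[i hi|/eqP ->|->]; rewrite ?eqxx ?orbT //.
by apply: pS; apply: leq_trans hi (leq_subr _ _).
Qed.

(** The up-sets of a chain are nested, hence distinguished by their sizes; so an
    up-set of [D] is determined by the sizes of its intersections with the
    fibres of [f]. *)
Lemma card_upsets (D : {set T}) (f : T -> T) (U : {set {set T}}) :
    (forall p q, p \in D -> q \in D -> f p = f q -> [|| p == q, lt p q | lt q p]) ->
    (forall u, u \in U -> u \subset D /\
       forall p q, p \in D -> q \in D -> lt p q -> p \in u -> q \in u) ->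
  #|U| <= \prod_(t in f @: D) #|[set p in D | f p == t]|.+1.
Proof.
move=> fchain UP.
pose h (u : {set T}) : {ffun T -> 'I_#|T|.+1} :=
  [ffun t => inord #|[set p in u | f p == t]|].
have hE u t : h u t = #|[set p in u | f p == t]| :> nat.
  by rewrite ffunE inordK // ltnS max_card.
pose F t := [pred i : 'I_#|T|.+1 | i < #|[set p in D | f p == t]|.+1].
have cardF t : #|F t| = #|[set p in D | f p == t]|.+1.
  set b := #|_| in F *; have hb : b.+1 <= #|T|.+1 by rewrite ltnS max_card.
  transitivity (\sum_(i < b.+1) 1); last by rewrite sum1_card card_ord.
  by rewrite -sum1_card (big_ord_widen _ (fun=> 1) hb).
have -> : \prod_(t in f @: D) #|[set p in D | f p == t]|.+1 = #|family F|.
  rewrite card_family foldrE big_image /= [RHS](bigID (mem (f @: D))) /=.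
  rewrite [X in _ = _ * X]big1 ?muln1; first by by apply: eq_bigr => t _; rewrite cardF.
  move=> t tD; rewrite cardF; congr _.+1; apply/eqP; rewrite cards_eq0.
  apply/eqP/setP => p; rewrite !inE; apply/negP => /andP[pD /eqP e].
  by rewrite -e imset_f in tD.
have h_inj : {in U &, injective h}.
  move=> u u' /UP[uD uup] /UP[u'D u'up] e.
  have sub t : [set p in u | f p == t] = [set p in u' | f p == t].
    have ct : #|[set p in u | f p == t]| = #|[set p in u' | f p == t]|.
      by rewrite -!hE e.
    have [s|] := boolP ([set p in u | f p == t] \subset [set p in u' | f p == t]).
      by apply/eqP; rewrite eqEcard s ct leqnn.
    have [s _|] := boolP ([set p in u' | f p == t] \subset [set p in u | f p == t]).
      by apply/eqP; rewrite eq_sym eqEcard s ct leqnn.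
    case/subsetPn => p; rewrite !inE => /andP[pu' /eqP pt]; rewrite pt eqxx andbT => pu.
    case/subsetPn => q; rewrite !inE => /andP[qu /eqP qt]; rewrite qt eqxx andbT => qu'.
    have pD := subsetP u'D p pu'; have qD := subsetP uD q qu.
    case/or3P: (fchain p q pD qD (etrans pt (esym qt))) => [/eqP pq|pq|pq].
    - by rewrite pq qu in pu.
    - by rewrite (u'up p q) in qu'.
    - by rewrite (uup q p) in pu.
  apply/setP => p; move/setP/(_ p): (sub (f p)); rewrite !inE eqxx !andbT.
  by [].
rewrite -(card_in_imset h_inj); apply/subset_leq_card/subsetP => _ /imsetP[u uU ->].
apply/familyP => t; rewrite inE /= hE ltnS; apply/subset_leq_card/subsetP => p.
by rewrite !inE => /andP[pu ->]; have [uD _] := UP u uU; rewrite (subsetP uD).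
Qed.

End Dilworth.

(** * Numerical bounds and the main theorem *)

Lemma bernoulli_nat (x r : nat) : (r < x)%N -> ((x - r) * x ^ r <= x * x.-1 ^ r)%N.
Proof.
elim: r => [|r IHr] rx; first by rewrite subn0 !expn0.
have := leq_mul (IHr (ltnW rx)) (leqnn x.-1).
rewrite -mulnA [(x ^ r * _)%N]mulnC mulnA -[(x * _ * _)%N]mulnA -expnSr.
apply: leq_trans; rewrite expnS mulnA leq_mul2r; apply/orP; right.
by have [y ->] : exists y, x = (y + r.+1)%N; [exists (x - r.+1)%N; lia|nia].
Qed.

(** Both sides are equal to [2 ^+ r] at [d = r]. Increasing [d] by one multiplies
    the right-hand side by [(d + 1 + r) / (d + 1)] and the left-hand side by
    [((d + 1 + r) / (d + r)) ^+ r], which is smaller by Bernoulli's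
    inequality. *)
Lemma mean_power_bound (d r : nat) : (r <= d)%N ->
  ((d + r)%:R / r%:R) ^+ r <=
    \prod_(1 <= l < d.+1) ((l + minn l r)%:R / l%:R) :> rat.
Proof.
move=> /subnKC <-; elim: (d - r)%N => {d}[|e IHe].
  rewrite addn0; have [->|r0] := posnP r; first by rewrite big_nil expr0.
  rewrite (eq_big_nat _ _ (F2 := fun=> 2)).
    by rewrite prodr_const_nat subn1 /= addnn -mul2n natrM mulfK // pnatr_eq0 -lt0n.
  move=> l /andP[l0 lr]; rewrite (minn_idPl _) // addnn -mul2n natrM mulfK //.
  by rewrite pnatr_eq0 -lt0n.
rewrite addnS big_nat_recr /=; last by lia.
move: (r + e)%N IHe (leq_addr e r) => {e}d IHe rd.
have -> : minn d.+1 r = r by apply/minn_idPr; apply: ltnW.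
apply: le_trans (ler_wpM2r _ IHe); last by rewrite divr_ge0 ?ler0n.
have [r0|r0] := posnP r.
  by rewrite r0 !expr0 mul1r addn0 divff // pnatr_eq0.
have rr0 : r%:R ^+ r != 0 :> rat by rewrite expf_neq0 // pnatr_eq0 -lt0n.
rewrite !expr_div_n ler_pdivrMr ?exprn_gt0 ?ltr0n //.
rewrite mulrAC divfK // mulrA ler_pdivlMr ?ltr0n //.
rewrite -!natrX -!natrM ler_nat mulnC [leqRHS]mulnC.
have := @bernoulli_nat (d.+1 + r) r ltac:(lia).
by rewrite addnK.
Qed.

(** The arithmetic-geometric mean inequality: the factors add up to
    [#|D| + #|f @: D|]. *)
Lemma prod_fibers_bound (T : finType) (D : {set T}) (f : T -> T) :
  (\prod_(t in f @: D) #|[set p in D | f p == t]|.+1)%:R <=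
    ((#|D| + #|f @: D|)%:R / #|f @: D|%:R) ^+ #|f @: D| :> rat.
Proof.
rewrite natr_prod; apply: le_trans (leif_AGM _).1 _ => [t _|]; first exact: ler0n.
rewrite -natr_sum; have -> // : (\sum_(t in f @: D) #|[set p in D | f p == t]|.+1 =
  #|D| + #|f @: D|)%N.
rewrite (eq_bigr (fun t => #|[set p in D | f p == t]| + 1)%N); last first.
  by move=> t _; rewrite addn1.
rewrite big_split /= sum1_card; congr (_ + _)%N.
rewrite -[RHS]sum1_card [RHS](partition_big f (mem (f @: D))) /=; last first.
  by move=> p pD; apply: imset_f.
apply: eq_bigr => t _; rewrite -sum1_card; apply: eq_bigl => p.
by rewrite inE.
Qed.

(** Take the first [l] elements of an enumeration of [P] that starts with
    [A]. *)
Lemma exists_subset_card_setI (T : finType) (A P : {set T}) l :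
  A \subset P -> (l <= #|P|)%N ->
  exists L : {set T}, [/\ L \subset P, #|L| = l & #|L :&: A| = minn l #|A|].
Proof.
move=> AP lP; pose s := enum A ++ enum (P :\: A).
have su : uniq s.
  rewrite cat_uniq !enum_uniq andbT /=; apply/hasPn => x.
  by rewrite !mem_enum in_setD => /andP[].
have sP x : x \in s -> x \in P.
  by rewrite mem_cat !mem_enum in_setD => /orP[/(subsetP AP)|/andP[]].
have ss : size s = #|P|.
  by rewrite size_cat -!cardE cardsD (setIidPr AP) subnKC // subset_leq_card.
exists [set x in take l s]; split.
- by apply/subsetP => x; rewrite inE => /mem_take/sP.
- by rewrite cardsE (card_uniqP (take_uniq l su)) size_takel // ss.
have -> : [set x in take l s] :&: A = [set x in take l (enum A)].
  apply/setP => x; rewrite !inE take_cat -cardE; case: ltnP => lA.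
    by apply: andb_idr => /mem_take; rewrite mem_enum.
  rewrite mem_cat [take l _]take_oversize -?cardE // mem_enum.
  have [//|xA /=] := boolP (x \in A); last by rewrite andbF.
by rewrite cardsE (card_uniqP (take_uniq l (enum_uniq _))) size_take_min -cardE.
Qed.

Lemma prod_ge_of_bounds (N c d r : nat) (M : nat -> nat) :
    (r <= d)%N -> (d <= c)%N ->
    N%:R <= ((d + r)%:R / r%:R) ^+ r :> rat ->
    (forall l, (1 <= l <= c)%N -> (l <= M l)%N) ->
    (forall l, (1 <= l <= d)%N -> (l + minn l r <= M l)%N) ->
  N%:R <= (\prod_(1 <= l < c.+1) M l)%N%:R / (c`!)%:R :> rat.
Proof.
move=> rd dc Nle M1 M2; apply: le_trans Nle _; apply: le_trans (mean_power_bound rd) _.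
rewrite fact_prod !natr_prod -prodf_div /=.
rewrite (@big_cat_nat _ _ _ d.+1 1 c.+1) //=.
rewrite -[leLHS]mulr1; apply: ler_pM; rewrite ?ler01 //.
- by apply: prodr_ge0 => l _; rewrite divr_ge0 ?ler0n.
- rewrite !big_seq; apply: ler_prod => l; rewrite mem_index_iota => /andP[l1 l2].
  rewrite divr_ge0 ?ler0n //= ler_pM2r ?invr_gt0 ?ltr0n // ler_nat M2 //.
  by rewrite l1.
rewrite big_seq; apply: (big_ind (fun x : rat => 1 <= x)) => //.
  by move=> x y; apply: mulr_ege1.
move=> l; rewrite mem_index_iota => /andP[l1 l2].
by rewrite ler_pdivlMr ?ltr0n ?mul1r ?ler_nat ?M1 //; lia.
Qed.

Unset Implicit Arguments.
Set Strict Implicit.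

Theorem theorem1p2 (k : fieldType) (V : finType) (E : rel V)
    (E_sym : symmetric E) (E_irr : irreflexive E) (E_bip : bipartite E)
    (c : nat) (ht_c : height_is (edge_ideal k E) c)
    (e : rat) (mult_e : multiplicity_is (edge_ideal k E) e)
    (M : nat -> nat)
    (M_max : forall l : nat, (1 <= l <= c)%N ->
               max_twist_is (edge_ideal k E) l (M l)) :
  e <= (\prod_(1 <= l < c.+1) M l)%N%:R / (c`!)%:R.
Proof.
have [tau [[C0 C0E C0tau] tau_min] ->] := multiplicity_min_covers E_irr mult_e.
set covs := [set C : {set V} | _].
have tau_c : (tau <= c)%N.
  have [C CE Cc] := height_ge_vertex_cover ht_c.
  exact: leq_trans (tau_min C CE) Cc.
have [A hA] := E_bip.
pose S := [set p : V * V | [&& E p.1 p.2, p.1 \in A & p.2 \notin A]].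
have [||Mt [MtS Mm tauM]] := @koenig _ A S tau.
- by move=> p; rewrite inE => /and3P[_ -> ->].
- move=> C /forall_inP SC; apply: tau_min; apply/vertex_coverP => x y xy.
  have := hA x y xy; case xA: (x \in A) => yA.
    by apply: (SC (x, y)); rewrite inE /= xy xA.
  by rewrite orbC; apply: (SC (y, x)); rewrite inE /= E_sym xy xA andbT; move: yA;
    case: (y \in A).
pose T : finType := {p : V * V | p \in Mt}.
pose X (t : T) := (val t).1; pose Y (t : T) := (val t).2.
have tS (t : T) : [/\ E (X t) (Y t), X t \in A & Y t \notin A].
  by have := subsetP MtS _ (valP t); rewrite inE => /and3P[].
have X_inj : injective X.
  by move=> s t e'; apply/val_inj/(Mm _ _ (valP s) (valP t)); rewrite [_.1]e' eqxx.
have Y_inj : injective Y.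
  by move=> s t e'; apply/val_inj/(Mm _ _ (valP s) (valP t));
    rewrite [(val s).2]e' eqxx orbT.
have XY i j : X i != Y j.
  have [_ iA _] := tS i; have [_ _ jA] := tS j.
  by apply: contraNneq jA => <-.
have XX i j : ~~ E (X i) (X j).
  have [_ iA _] := tS i; have [_ jA _] := tS j.
  by apply/negP => /hA; rewrite iA jA.
have YY i j : ~~ E (Y i) (Y j).
  have [_ _ iA] := tS i; have [_ _ jA] := tS j.
  by apply/negP => /hA; rewrite (negPf iA) (negPf jA).
have cardT : #|T| = #|Mt| by rewrite card_sig.
have covsP C : C \in covs -> vertex_cover E C /\ #|C| = tau.
  by rewrite inE => /andP[? /eqP].
have pick_inj (C : {set V}) : injective (fun t => if X t \in C then X t else Y t).
  move=> s t /=; case: ifP => _; case: ifP => _ // h.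
  - exact: X_inj.
  - by have := XY s t; rewrite h eqxx.
  - by have := XY t s; rewrite h eqxx.
  - exact: Y_inj.
(* The matching has at least as many edges as a minimum cover has elements, and
   the cover meets each edge; so it consists of one end of each edge. *)
have trace C : C \in covs ->
    C = [set if X t \in C then X t else Y t | t : T].
  move=> /covsP[/vertex_coverP CE Ctau]; apply/esym/eqP.
  rewrite eqEcard card_imset // cardT Ctau tauM andbT.
  apply/subsetP => _ /imsetP[t _ ->]; case: ifP => // XC.
  by have [XYt _ _] := tS t; have := CE _ _ XYt; rewrite XC.
have exactly_one C t : C \in covs -> X t \in C -> Y t \notin C.
  move=> Cc XC; rewrite (trace C Cc); apply/negP => /imsetP[s _].
  case: ifP => [_ h|XsC h]; first by have := XY s t; rewrite h eqxx.
  by move: XsC; rewrite -(Y_inj _ _ h) XC.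
(* [K s \subset K t] is the preorder on the edges of the matching. *)
pose K (t : T) := [set C in covs | X t \in C].
have KE t C : C \in covs -> (C \in K t) = (X t \in C).
  by move=> Cc; rewrite in_set Cc.
pose lt (s t : T) := K s \proper K t.
have arcK i j : E (X i) (Y j) -> K j \subset K i.
  move=> ij; apply/subsetP => C; rewrite !(inE, in_setI) => /andP[Cc Xj].
  have Cc' : C \in covs by rewrite inE.
  rewrite Cc /=; have [/vertex_coverP/(_ _ _ ij) + _] := covsP C Cc'.
  by rewrite (negPf (exactly_one C j Cc' Xj)) orbF.
(* Representatives of the edges up to equality of [K]. *)
pose P := [set i | [forall j, (K j == K i) ==> (enum_rank i <= enum_rank j)%N]].
have rep i : exists2 j, j \in P & K j = K i.
  have [j /eqP jK jmin] := @arg_minnP T i (fun j => K j == K i)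
    (fun j => enum_rank j) (eqxx _).
  exists j => //; rewrite inE; apply/forallP => j'; apply/implyP => /eqP h.
  by apply: jmin; rewrite h jK.
have P_inj : {in P &, injective K}.
  move=> i j; rewrite !inE => /forallP hi /forallP hj KK.
  apply/enum_rank_inj/ord_inj/eqP; rewrite eqn_leq.
  by rewrite (implyP (hi j)) ?(implyP (hj i)) ?KK.
have lt_irr : irreflexive lt by move=> t; apply: properxx.
have lt_trans : transitive lt by move=> y x z; apply: proper_trans.
have [Ac [f [AP Aanti fA fchain]]] := dilworth lt_irr lt_trans P.
(* This is also the number of chains, as [f] is injective on antichains. *)
pose r := #|Ac|.
have f_inj : {in Ac &, injective f}.
  move=> p q pA qA h; case/or3P: (fchain p q (subsetP AP _ pA) (subsetP AP _ qA) h).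
  - by move/eqP.
  - by rewrite (negPf (Aanti p q pA qA)).
  - by rewrite (negPf (Aanti q p qA pA)).
have fAP : f @: Ac = f @: P.
  by apply/eqP; rewrite eqEcard imsetS //= (card_in_imset f_inj).
have rE : #|f @: P| = r by rewrite -fAP card_in_imset.
have comparable i : i \in P ->
    [|| i \in Ac, [exists a in Ac, lt i a] | [exists a in Ac, lt a i]].
  move=> iP; have : f i \in f @: Ac by rewrite fAP imset_f.
  case/imsetP => a aA h; case/or3P: (fchain i a iP (subsetP AP _ aA) h) => [/eqP ->|h'|h'].
  - by rewrite aA.
  - by apply/or3P/Or32/existsP; exists a; rewrite aA.
  - by apply/or3P/Or33/existsP; exists a; rewrite aA.
pose tr (C : {set V}) := [set i in P | X i \in C].
have tr_inj : {in covs &, injective tr}.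
  move=> C C' Cc C'c h.
  have XC t : (X t \in C) = (X t \in C').
    have [s sP Ks] := rep t.
    rewrite -(KE t C Cc) -(KE t C' C'c) -Ks !KE //.
    by move/setP/(_ s): h; rewrite ![_ \in tr _]in_set sP.
  by rewrite (trace C Cc) (trace C' C'c); apply: eq_imset => t; rewrite XC.
have rd : (r <= #|P|)%N by apply: subset_leq_card.
have PT : (#|P| <= tau)%N.
  have C0c : C0 \in covs by rewrite inE C0E C0tau eqxx.
  apply: leq_trans (max_card _) _.
  by rewrite -C0tau (trace C0 C0c) card_imset.
have Nle : #|covs|%:R <= ((#|P| + r)%:R / r%:R) ^+ r :> rat.
  rewrite -rE; apply: le_trans (prod_fibers_bound _ _).
  rewrite ler_nat -(card_in_imset tr_inj).
  apply: (@card_upsets _ lt _ _ _ fchain) => u /imsetP[C Cc ->]; split.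
    by apply/subsetP => i; rewrite inE => /andP[].
  by move=> p q pP qP /proper_sub/subsetP/(_ C); rewrite !KE // ![_ \in tr _]in_set pP qP.
apply: (prod_ge_of_bounds rd (leq_trans PT tau_c) Nle).
  by move=> l /M_max[[F Fres h] _]; exact: (tor_degree_ge Fres h).
move=> l /andP[l1 lP].
have lc : (l <= c)%N by apply: leq_trans lP (leq_trans PT tau_c).
have [[F Fres _] _] := M_max l ltac:(by rewrite l1).
have [L [LP Ll LA]] := exists_subset_card_setI AP lP.
(* Since [Ac] is a maximum antichain, each element of [L] is in [Ac], below an
   element of [Ac] or above one. *)
pose Bel := [set i in L | [exists a in Ac, lt i a]].
pose Abv := [set i in L | [exists a in Ac, lt a i]].
have L0 : L != set0 by rewrite -card_gt0 Ll.
have BelL : Bel \subset L by apply/subsetP => i; rewrite inE => /andP[].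
have AbvL : Abv \subset L by apply/subsetP => i; rewrite inE => /andP[].
have dis : [disjoint Bel & Abv].
  rewrite -setI_eq0; apply/eqP/setP => i; rewrite !inE; apply/negP.
  case/andP=> /andP[_ /existsP[a /andP[aA ia]]] /andP[_ /existsP[b /andP[bA bi]]].
  by move: (Aanti b a bA aA); rewrite (lt_trans _ _ _ bi ia).
have dis2 : [disjoint Bel :|: Abv & L :&: Ac].
  rewrite -setI_eq0; apply/eqP/setP => i; rewrite !inE; apply/negP.
  case/andP=> h /andP[_ iA]; case/orP: h => /andP[_ /existsP[a /andP[aA h]]].
    by move: (Aanti i a iA aA); rewrite h.
  by move: (Aanti a i aA iA); rewrite h.
have [|j jge jF] := @edge_ideal_tor_nonvanishing k V E T X Y X_inj Y_inj XY
  (fun i => let: And3 h _ _ := tS i in h) XX YY E_sym F L Bel Abv Fres L0 BelL AbvL dis.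
  move=> i j iL jL ij /arcK Kji.
  have iP := subsetP LP i iL; have jP := subsetP LP j jL.
  have ji : lt j i.
    rewrite /lt properEneq Kji andbT; apply: contraNneq ij => h.
    by rewrite (P_inj j i jP iP h).
  rewrite !inE iL jL /=; case/or3P: (comparable i iP) => [iA|/existsP[a /andP[aA ia]]|->].
  - by apply/orP; left; apply/existsP; exists i; rewrite iA.
  - by apply/orP; left; apply/existsP; exists a; rewrite aA (lt_trans _ _ _ ji ia).
  - by rewrite orbT.
have jM : (j <= M l)%N.
  by have [_] := M_max l ltac:(by rewrite l1); apply; exists F => //; rewrite -Ll.
have sz : (#|Bel| + #|Abv| + #|L :&: Ac| <= #|L|)%N.
  move: dis dis2; rewrite -!leq_card_setU => /eqP <- /eqP <-.
  by apply: subset_leq_card; rewrite !subUset BelL AbvL subsetIl.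
by move: jge jM sz; rewrite LA Ll -/r; lia.
Qed.
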